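(* Let $\lambda$ be a limit ordinal, let $j\in\mathcal{E}_\lambda$, and let $\langle\gamma_n : n<\omega\rangle$ be the increasing enumeration of $\mathrm{cr}\,\mathcal{A}_j=\{\mathrm{cr}\,k: k\in\mathcal{A}_j\}$. Then: (i) For all $n<\omega$, $j_{(2^n)}(\mathrm{cr}\,j_{(2^n)})=\mathrm{cr}\,j_{(2^{n+1})}$ (so in particular $\langle \mathrm{cr}\,j_{(2^n)} : n<\omega\rangle$ is increasing). And for every $m\geq 1$, $\mathrm{cr}\,j_{(m)}=\mathrm{cr}\,j_{(2^n)}$, where $n$ is greatest such that $2^n$ divides $m$. (ii) For all $n<\omega$, $\mathrm{cr}\,j_{(2^n)}=\gamma_n$. (iii) For all $n\ge 1$, if $i,m<2^n$ and $i\neq m$, then $j_{(i)}\overset{*}{\cap} V_{\gamma_{n-1}+1}\neq j_{(m)}\overset{*}{\cap} V_{\gamma_{n-1}+1}$. (iv) For all $n<\omega$, $P_n=\{j_{(i)}\overset{*}{\cap} V_{\gamma_n} : i<2^n\}$.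
   Context: For a limit ordinal $\lambda$, $\mathcal{E}_\lambda$ is the set of all elementary embeddings $j:(V_\lambda,\in)\to(V_\lambda,\in)$ that are not the identity; $\mathrm{cr}\,j$ denotes the critical point of $j$. For $j,k\in\mathcal{E}_\lambda$ define the application $j\cdot k=jk=\bigcup_{\alpha<\lambda} j(k\cap V_\alpha)$ (where $k$ is regarded as a set of ordered pairs); then $jk\in\mathcal{E}_\lambda$. Let $j\circ k$ be the composition of $j$ and $k$. $\mathcal{A}_j$ is the closure of $\{j\}$ under $\cdot$, and $\mathcal{P}_j$ is the closure of $\{j\}$ under $\cdot$ and $\circ$. The set $\mathrm{cr}\,\mathcal{A}_j$ has order type $\omega$, so the enumeration $\langle\gamma_n:n<\omega\rangle$ makes sense (and $\gamma_0=\mathrm{cr}\,j$). Let $j_{(0)}=\mathrm{id}$ (the identity on $V_\lambda$, which is not in $\mathcal{E}_\lambda$), $j_{(1)}=j$, and $j_{(n+1)}=j_{(n)}\cdot j$ for $n\ge1$. For $k\in\mathcal{E}_\lambda\cup\{\mathrm{id}\}$ and $\theta<\lambda$, $k\overset{*}{\cap}V_\theta=\{\langle x,y\rangle\in V_\theta\times V_\theta : y\in k(x)\}$. For $n<\omega$, $P_n=\{p\overset{*}{\cap}V_{\gamma_n} : p\in\mathcal{P}_j\}$. *)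

(* Defs.v *)
From Stdlib Require Import Arith Wellfounded Classical ClassicalEpsilon
  FunctionalExtensionality PropExtensionality ProofIrrelevance.

(** [vset] is the cumulative hierarchy over the types of one Rocq universe:
    well-founded trees, identified when they are extensionally equal.  The
    quotient is taken by choosing one tree in each class, so equality of
    [vset]s is Leibniz equality.  With the classical axioms loaded above it
    satisfies ZFC. *)

Inductive tree : Type := node (A : Type) (f : A -> tree).

Fixpoint eqt (s t : tree) {struct s} : Prop :=
  match s, t with
  | node A f, node B g =>
      (forall a, exists b, eqt (f a) (g b)) /\
      (forall b, exists a, eqt (f a) (g b))
  end.

Lemma eqt_refl s : eqt s s.
Proof. induction s as [A f IH]; split; intro a; exists a; apply IH. Qed.

Lemma eqt_sym s t : eqt s t -> eqt t s.
Proof.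
  revert t; induction s as [A f IH]; intros [B g] [H1 H2]; split.
  - intro b; destruct (H2 b) as [a Ha]; exists a; now apply IH.
  - intro a; destruct (H1 a) as [b Hb]; exists b; now apply IH.
Qed.

Lemma eqt_trans s t u : eqt s t -> eqt t u -> eqt s u.
Proof.
  revert t u; induction s as [A f IH]; intros [B g] [C h] [H1 H2] [K1 K2]; split.
  - intro a; destruct (H1 a) as [b Hb]; destruct (K1 b) as [c Hc].
    exists c; now apply IH with (g b).
  - intro c; destruct (K2 c) as [b Hb]; destruct (H2 b) as [a Ha].
    exists a; now apply IH with (g b).
Qed.

Definition canon (t : tree) : tree := epsilon (inhabits t) (eqt t).

Lemma canon_eqt t : eqt t (canon t).
Proof. apply (epsilon_spec (inhabits t) (eqt t)); exists t; apply eqt_refl. Qed.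

Lemma canon_eq s t : eqt s t -> canon s = canon t.
Proof.
  intro H; unfold canon.
  rewrite (proof_irrelevance _ (inhabits s) (inhabits t)).
  f_equal; extensionality u; apply propositional_extensionality; split; intro K.
  - now apply eqt_trans with s; [apply eqt_sym|].
  - now apply eqt_trans with t.
Qed.

Definition vset : Type := {t : tree | canon t = t}.

Definition cls (t : tree) : vset :=
  exist _ (canon t) (eq_sym (canon_eq _ _ (canon_eqt t))).

Lemma vset_eq (x y : vset) : eqt (proj1_sig x) (proj1_sig y) -> x = y.
Proof.
  destruct x as [s Hs], y as [t Ht]; simpl; intro H.
  assert (s = t) by (rewrite <- Hs, <- Ht; now apply canon_eq).
  subst t; f_equal; apply proof_irrelevance.
Qed.

Definition tidx (t : tree) : Type := let (A, _) := t in A.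
Definition tsub (t : tree) : tidx t -> tree :=
  match t with node A f => f end.

(** Every set [x] is the range of the small family [elt x : idx x -> vset]. *)
Definition idx (x : vset) : Type := tidx (proj1_sig x).
Definition elt (x : vset) (i : idx x) : vset := cls (tsub (proj1_sig x) i).

Definition mem (x y : vset) : Prop := exists i : idx y, elt y i = x.

Declare Scope vset_scope.
Delimit Scope vset_scope with vset.
Open Scope vset_scope.
Notation "x '∈' y" := (mem x y) (at level 70) : vset_scope.

Definition range {I : Type} (F : I -> vset) : vset :=
  cls (node I (fun i => proj1_sig (F i))).

Lemma cls_eqt s t : cls s = cls t -> eqt s t.
Proof.
  intro H; apply (f_equal (@proj1_sig _ _)) in H; simpl in H.
  apply eqt_trans with (canon s); [apply canon_eqt|].
  rewrite H; apply eqt_sym, canon_eqt.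
Qed.

Lemma cls_repr (x : vset) : cls (proj1_sig x) = x.
Proof. apply vset_eq; simpl; apply eqt_sym, canon_eqt. Qed.

Lemma mem_cls t x : x ∈ cls t <-> exists i : tidx t, cls (tsub t i) = x.
Proof.
  pose proof (canon_eqt t) as H; unfold mem, elt, idx; simpl.
  destruct t as [A f], (canon (node A f)) as [B g]; destruct H as [H1 H2]; simpl.
  split; intros [i Hi]; subst x.
  - destruct (H2 i) as [a Ha]; exists a; apply vset_eq; simpl.
    rewrite (canon_eq _ _ Ha); apply eqt_refl.
  - destruct (H1 i) as [b Hb]; exists b; apply vset_eq; simpl.
    rewrite (canon_eq _ _ Hb); apply eqt_refl.
Qed.

Lemma mem_range {I : Type} (F : I -> vset) x : x ∈ range F <-> exists i, F i = x.
Proof.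
  unfold range; rewrite mem_cls; simpl.
  split; intros [i Hi]; exists i; rewrite cls_repr in *; assumption.
Qed.

Lemma vset_ext x y : (forall z, z ∈ x <-> z ∈ y) -> x = y.
Proof.
  intro H; apply vset_eq; rewrite <- (cls_repr x), <- (cls_repr y) in H.
  destruct (proj1_sig x) as [A f], (proj1_sig y) as [B g]; split.
  - intro a; destruct (proj1 (mem_cls (node B g) (cls (f a)))) as [b Hb].
    { apply H, mem_cls; now exists a. }
    exists b; apply eqt_sym; now apply cls_eqt.
  - intro b; destruct (proj1 (mem_cls (node A f) (cls (g b)))) as [a Ha].
    { apply H, mem_cls; now exists b. }
    exists a; now apply cls_eqt.
Qed.

Lemma mem_wf : well_founded mem.
Proof.
  intro x; rewrite <- (cls_repr x); generalize (proj1_sig x); intro t.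
  induction t as [A f IH]; constructor; intros y Hy.
  destruct (proj1 (mem_cls (node A f) y) Hy) as [a Ha]; subst y; apply IH.
Qed.

Lemma elt_mem x (i : idx x) : elt x i ∈ x.
Proof. now exists i. Qed.

Definition image (a : vset) (F : vset -> vset) : vset :=
  range (fun i : idx a => F (elt a i)).

Definition sep (a : vset) (P : vset -> Prop) : vset :=
  range (fun i : {i : idx a | P (elt a i)} => elt a (proj1_sig i)).

Definition union (a : vset) : vset :=
  range (fun p : {i : idx a & idx (elt a i)} =>
           elt (elt a (projT1 p)) (projT2 p)).

Definition power (a : vset) : vset :=
  range (fun P : idx a -> Prop =>
           range (fun i : {i : idx a | P i} => elt a (proj1_sig i))).

Definition upair (a b : vset) : vset :=
  range (fun c : bool => if c then a else b).

Definition sing (a : vset) : vset := upair a a.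

Definition cup (a b : vset) : vset := union (upair a b).

Definition cap (a b : vset) : vset := sep a (fun x => x ∈ b).

Definition succ (a : vset) : vset := cup a (sing a).

Definition opair (x y : vset) : vset := upair (sing x) (upair x y).

Definition prod (a b : vset) : vset :=
  union (image a (fun x => image b (fun y => opair x y))).

(** The unique [x] in [a] with [P x] (and the empty set if there is none). *)
Definition the (a : vset) (P : vset -> Prop) : vset := union (sep a P).

Lemma mem_image a F x : x ∈ image a F <-> exists y, y ∈ a /\ F y = x.
Proof.
  unfold image; rewrite mem_range; split.
  - intros [i Hi]; exists (elt a i); split; [apply elt_mem | assumption].
  - intros [y [[i Hi] Hy]]; exists i; now rewrite Hi.
Qed.

Lemma mem_sep a P x : x ∈ sep a P <-> x ∈ a /\ P x.
Proof.
  unfold sep; rewrite mem_range; split.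
  - intros [[i Hi] Hx]; simpl in Hx; subst x; split; [apply elt_mem | assumption].
  - intros [[i Hi] Hx]; subst x; now exists (exist _ i Hx).
Qed.

Lemma mem_union a x : x ∈ union a <-> exists y, y ∈ a /\ x ∈ y.
Proof.
  unfold union; rewrite mem_range; split.
  - intros [[i k] Hx]; simpl in Hx; subst x.
    exists (elt a i); split; apply elt_mem.
  - intros [y [[i Hi] [k Hk]]]; subst y; now exists (existT _ i k).
Qed.

Lemma mem_power a x : x ∈ power a <-> forall y, y ∈ x -> y ∈ a.
Proof.
  unfold power; rewrite mem_range; split.
  - intros [P Hx] y Hy; subst x; rewrite mem_range in Hy.
    destruct Hy as [[i Hi] Hy]; subst y; apply elt_mem.
  - intro H; exists (fun i => elt a i ∈ x); apply vset_ext; intro z.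
    rewrite mem_range; split.
    + intros [[i Hi] Hz]; now subst z.
    + intro Hz; destruct (H z Hz) as [i Hi]; subst z; now exists (exist _ i Hz).
Qed.

Lemma mem_upair a b x : x ∈ upair a b <-> x = a \/ x = b.
Proof.
  unfold upair; rewrite mem_range; split.
  - intros [[|] H]; auto.
  - intros [H|H]; [exists true | exists false]; auto.
Qed.

Lemma the_eq a P x : x ∈ a -> P x -> (forall y, y ∈ a -> P y -> y = x) -> the a P = x.
Proof.
  intros Ha Hx Hu; apply vset_ext; intro z; unfold the; rewrite mem_union; split.
  - intros [y [Hy Hz]]; apply mem_sep in Hy; now rewrite <- (Hu y) by apply Hy.
  - intro Hz; exists x; now rewrite mem_sep.
Qed.

Definition transitive (a : vset) : Prop :=
  forall x y, x ∈ a -> y ∈ x -> y ∈ a.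

(** As ∈ is well-founded ([mem_wf]), such a set is well-ordered by ∈. *)
Definition ordinal (a : vset) : Prop :=
  transitive a /\ forall x, x ∈ a -> transitive x.

Definition limit_ordinal (a : vset) : Prop :=
  ordinal a /\ (exists x, x ∈ a) /\ forall x, x ∈ a -> succ x ∈ a.

Definition Vr : vset -> vset :=
  Fix mem_wf (fun _ => vset)
    (fun a rec =>
       union (range (fun i : idx a => power (rec (elt a i) (elt_mem a i))))).

Lemma Vr_eq a : Vr a = union (image a (fun b => power (Vr b))).
Proof.
  unfold Vr at 1; rewrite Fix_eq; [reflexivity|].
  intros x f g H; do 2 f_equal; extensionality i; now rewrite H.
Qed.

Definition is_fun (f a b : vset) : Prop :=
  (forall p, p ∈ f -> p ∈ prod a b) /\
  (forall x, x ∈ a -> exists! y, opair x y ∈ f).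

(** [x] and [y] lie in the double union of [f] when [opair x y ∈ f]. *)
Definition app (f x : vset) : vset :=
  the (union (union f)) (fun y => opair x y ∈ f).

Definition graph (a : vset) (F : vset -> vset) : vset :=
  image a (fun x => opair x (F x)).

(** Formulas of set theory with de Bruijn variables: [FAll] binds variable 0. *)

Inductive fml : Type :=
  | FMem (m n : nat)
  | FEq (m n : nat)
  | FNot (p : fml)
  | FAnd (p q : fml)
  | FAll (p : fml).

Definition scons (x : vset) (v : nat -> vset) (n : nat) : vset :=
  match n with 0 => x | S n => v n end.

(** [sat M v p]: the structure [(M, ∈)] satisfies [p] under the assignment [v]. *)
Fixpoint sat (M : vset) (v : nat -> vset) (p : fml) : Prop :=
  match p with
  | FMem m n => v m ∈ v n
  | FEq m n => v m = v n
  | FNot p => ~ sat M v p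
  | FAnd p q => sat M v p /\ sat M v q
  | FAll p => forall x, x ∈ M -> sat M (scons x v) p
  end.

Definition elementary (M N j : vset) : Prop :=
  is_fun j M N /\
  forall (p : fml) (v : nat -> vset), (forall n, v n ∈ M) ->
    (sat M v p <-> sat N (fun n => app j (v n)) p).

Definition idV (lam : vset) : vset := graph (Vr lam) (fun x => x).

(** The class 𝓔_λ, for [lam] = λ. *)
Definition E (lam j : vset) : Prop :=
  elementary (Vr lam) (Vr lam) j /\ j <> idV lam.

Definition is_crit (j k : vset) : Prop :=
  app j k <> k /\ forall a, a ∈ k -> app j a = a.

(** The elements of [lam] are the ordinals of [Vr lam], so this is the least
    ordinal moved by [j]. *)
Definition cr (lam j : vset) : vset := the lam (is_crit j).

(** The application j·k = ⋃_{α<λ} j(k ∩ V_α). *)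
Definition dot (lam j k : vset) : vset :=
  union (image lam (fun a => app j (cap k (Vr a)))).

Definition comp (lam j k : vset) : vset :=
  graph (Vr lam) (fun x => app j (app k x)).

(** 𝓐_j and 𝓟_j: the closures of {j} under [dot], and under [dot] and [comp]. *)
Inductive A (lam j : vset) : vset -> Prop :=
  | A_gen : A lam j j
  | A_dot k l : A lam j k -> A lam j l -> A lam j (dot lam k l).

Inductive P (lam j : vset) : vset -> Prop :=
  | P_gen : P lam j j
  | P_dot k l : P lam j k -> P lam j l -> P lam j (dot lam k l)
  | P_comp k l : P lam j k -> P lam j l -> P lam j (comp lam k l).

Definition crA (lam j c : vset) : Prop := exists k, A lam j k /\ c = cr lam k.

(** [g] is the increasing enumeration, in order type ω, of the class [C] of
    ordinals (on ordinals, ∈ is the strict order). *)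
Definition increasing_enumeration (C : vset -> Prop) (g : nat -> vset) : Prop :=
  (forall m n, m < n -> g m ∈ g n) /\
  (forall c, C c <-> exists n, c = g n).

(** Left powers [j_(n)], with [j_(0) = id] and [j_(1) = j]. *)
Fixpoint lpow (lam j : vset) (n : nat) : vset :=
  match n with
  | 0 => idV lam
  | S m => match m with
           | 0 => j
           | S _ => dot lam (lpow lam j m) j
           end
  end.

(** {⟨x, y⟩ ∈ V_θ × V_θ : y ∈ k(x)}. *)
Definition starcap (k theta : vset) : vset :=
  sep (prod (Vr theta) (Vr theta))
      (fun p => exists x y, p = opair x y /\ y ∈ app k x).

(** Membership in P_n, for [theta] = γ_n. *)
Definition Pn (lam j theta : vset) (s : vset) : Prop :=
  exists p, P lam j p /\ s = starcap p theta.

(* Main.v *)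
Require Import Defs.
From Stdlib Require Import Arith Lia Classical FunctionalExtensionality
  PropExtensionality.

(** The proof works with the functions, called [embedding], that preserve all
    predicates built from [x ∈ y] and [y = Vr x] with connectives and bounded
    quantifiers.  The given [j] is one because the hierarchy is definable over a limit level
    ([bounded_definable]), and application and composition keep this property.
    For the application the reason is that [k], restricted to a set [a], is itself
    a set in [Vr l] whose image under [j] is the restriction of [dot l j k] to
    [app j a] ([app_graph_dot]).  Whatever bounded statement holds of such
    restrictions of [k] thus holds of [dot l j k].  This gives that [dot l j k]
    is an [embedding] ([embedding_dot]), the distributive law
    [j(km) = (jk)(jm)] ([dot_distributive]), that [jk] has critical point
    [j (cr k)] ([dot_critical]), and that [starcap] commutes with application
    ([emb_starcap]).

    Let [agree t k m] say that [k] and [m] have the same [starcap] at [t].  For a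
    limit ordinal [t] it is a congruence for both operations, and it becomes
    stronger on the image: if [k] and [m] agree below [t], then [hk] and [hm]
    agree below [h t].  If some [j_(N)] agrees below [t] with the identity, then
    below [t] every member of [P l j] agrees with one of [j_(1), ..., j_(N)].
    This is the computation of the Laver tables: by distributivity
    [j_(i) j_(k+1) = (j_(i) j_(k)) j_(i+1)], so rows are computed downwards from
    row [N], and [j_(i) ∘ j_(k) = (j_(i) j_(k)) ∘ j_(i)] reduces composition to
    application ([P_represented]).

    The critical points of the left powers follow by induction on [n].  Let
    [N = 2 ^ n], [k = j_(N)], with critical point [γ_n], and [δ = k γ_n].  As [k]
    is the identity below [γ_n], the powers [j_(N+i)] and [j_(i)] agree there, so
    for [0 < i < N] they have the same critical point.  For [0 < i <= N], moreover,
    [j_(N+i)] agrees with [k j_(i)] below [δ] ([agree_double]); for [i = N] the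
    latter has critical point [δ], so that of [j_(2N)] is at least [δ], hence at
    least [γ_(n+1)].  Were it larger than [γ_(n+1)], [j_(2N)] would be the identity
    below it, so [j_(1), ..., j_(2N)] would represent all embeddings there, and
    [γ_(n+1)], which is the critical point of none of these powers, would not be in
    [crA] ([critical_double]).

    Parts (i) and (ii) are this computation, and (iv) is the representation with
    [N = 2 ^ n] and [t = γ_n].  For (iii), agreement up to [γ_(n-1) + 1] of
    two powers that move [γ_(n-1)] is preserved by multiplication by [j] on the
    right ([agree_dot_succ]), so it may be moved up until the later power is
    [j_(2 ^ n)], the identity on this level, whereas the earlier one still has
    its critical point at or below [γ_(n-1)]; if the earlier power is the identity
    [j_(0)], the critical point of the later one gives the contradiction at once
    ([lpow_disagree]). *)

(** * Sets, ordinals and the hierarchy *)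

Definition sub (x y : vset) : Prop := forall z, z ∈ x -> z ∈ y.
Notation "x '⊆' y" := (sub x y) (at level 70) : vset_scope.

Lemma sub_antisym x y : x ⊆ y -> y ⊆ x -> x = y.
Proof. intros H K; apply vset_ext; split; [apply H | apply K]. Qed.

Lemma mem_irrefl x : ~ x ∈ x.
Proof. induction (mem_wf x) as [x _ IH]; intro H; exact (IH x H H). Qed.

Lemma mem_asym x y : x ∈ y -> ~ y ∈ x.
Proof.
  revert y; induction (mem_wf x) as [x _ IH]; intros y H K.
  exact (IH y K x K H).
Qed.

Lemma mem_sing a x : x ∈ sing a <-> x = a.
Proof. unfold sing; rewrite mem_upair; tauto. Qed.

Lemma mem_cup a b x : x ∈ cup a b <-> x ∈ a \/ x ∈ b.
Proof.
  unfold cup; rewrite mem_union; split.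
  - intros [y [Hy Hx]]; apply mem_upair in Hy; destruct Hy; subst y; auto.
  - intros [H|H]; [exists a | exists b]; rewrite mem_upair; auto.
Qed.

Lemma mem_cap a b x : x ∈ cap a b <-> x ∈ a /\ x ∈ b.
Proof. unfold cap; now rewrite mem_sep. Qed.

Lemma mem_succ a x : x ∈ succ a <-> x ∈ a \/ x = a.
Proof. unfold succ; rewrite mem_cup, mem_sing; tauto. Qed.

Lemma sing_inj x y : sing x = sing y -> x = y.
Proof. intro H; apply mem_sing; rewrite <- H; now apply mem_sing. Qed.

Lemma opair_inj x y x' y' : opair x y = opair x' y' -> x = x' /\ y = y'.
Proof.
  unfold opair; intro H.
  assert (Hx : x = x').
  { assert (K : sing x' ∈ upair (sing x) (upair x y))
      by (rewrite H; apply mem_upair; auto).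
    apply mem_upair in K; symmetry; apply mem_sing.
    destruct K as [K|K]; [now rewrite <- K; apply mem_sing|].
    assert (Ex : x ∈ sing x') by (rewrite K; apply mem_upair; auto).
    apply mem_sing in Ex; subst x'; now apply mem_sing. }
  subst x'; split; [reflexivity|].
  assert (K1 : upair x y ∈ upair (sing x) (upair x y')) by
    (rewrite <- H; apply mem_upair; auto).
  assert (K2 : upair x y' ∈ upair (sing x) (upair x y)) by
    (rewrite H; apply mem_upair; auto).
  apply mem_upair in K1, K2.
  assert (Y1 : y ∈ upair x y) by (apply mem_upair; auto).
  assert (Y2 : y' ∈ upair x y') by (apply mem_upair; auto).
  destruct K1 as [K1|K1].
  - rewrite K1 in Y1; apply mem_sing in Y1; subst y.
    destruct K2 as [K2|K2]; rewrite K2 in Y2.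
    + apply mem_sing in Y2; auto.
    + apply mem_upair in Y2; destruct Y2; auto.
  - rewrite K1 in Y1; apply mem_upair in Y1; destruct Y1 as [Y1|Y1]; [|auto].
    subst y; rewrite <- K1 in Y2; apply mem_upair in Y2; destruct Y2; auto.
Qed.

Lemma mem_prod a b p :
  p ∈ prod a b <-> exists x y, x ∈ a /\ y ∈ b /\ p = opair x y.
Proof.
  unfold prod; rewrite mem_union; split.
  - intros [q [Hq Hp]]; apply mem_image in Hq; destruct Hq as [x [Hx Hq]].
    subst q; apply mem_image in Hp; destruct Hp as [y [Hy Hp]]; eauto.
  - intros [x [y [Hx [Hy Hp]]]].
    exists (image b (fun y => opair x y)); split; apply mem_image; eauto.
Qed.

Lemma opair_prod a b x y : opair x y ∈ prod a b <-> x ∈ a /\ y ∈ b.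
Proof.
  rewrite mem_prod; split; [|intros [Hx Hy]; now exists x, y].
  intros [x' [y' [Hx [Hy Hp]]]]; apply opair_inj in Hp; destruct Hp; now subst.
Qed.

Lemma mem_graph a F p : p ∈ graph a F <-> exists x, x ∈ a /\ p = opair x (F x).
Proof.
  unfold graph; rewrite mem_image; split; intros [x [Hx Hp]]; eauto.
Qed.

Lemma opair_graph a F x y : opair x y ∈ graph a F <-> x ∈ a /\ y = F x.
Proof.
  rewrite mem_graph; split.
  - intros [x' [Hx Hp]]; apply opair_inj in Hp; destruct Hp; subst; auto.
  - intros [Hx ->]; eauto.
Qed.

Lemma graph_ext a F G : (forall x, x ∈ a -> F x = G x) -> graph a F = graph a G.
Proof.
  intro H; apply vset_ext; intro p; rewrite !mem_graph; split;
    intros [x [Hx ->]]; exists x; rewrite (H x Hx); auto.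
Qed.

Lemma app_eq f x y :
  opair x y ∈ f -> (forall z, opair x z ∈ f -> z = y) -> app f x = y.
Proof.
  intros H U; unfold app; apply the_eq; auto.
  apply mem_union; exists (upair x y); split; [|apply mem_upair; auto].
  apply mem_union; exists (opair x y); split; [assumption|].
  unfold opair; apply mem_upair; auto.
Qed.

Lemma app_graph a F x : x ∈ a -> app (graph a F) x = F x.
Proof.
  intro Hx; apply app_eq; [now apply opair_graph|].
  intros z Hz; now apply opair_graph in Hz.
Qed.

Section IsFun.
Variables f a b : vset.
Hypothesis Hf : is_fun f a b.

Lemma is_fun_app x : x ∈ a -> opair x (app f x) ∈ f.
Proof.
  intro Hx; destruct (proj2 Hf x Hx) as [y [Hy U]].
  rewrite (app_eq f x y); auto; intros z Hz; symmetry; auto.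
Qed.

Lemma is_fun_val x : x ∈ a -> app f x ∈ b.
Proof.
  intro Hx; apply is_fun_app, (proj1 Hf), opair_prod in Hx; tauto.
Qed.

Lemma is_fun_graph : f = graph a (app f).
Proof.
  apply vset_ext; intro p; rewrite mem_graph; split.
  - intro Hp; destruct (proj1 (mem_prod _ _ _) (proj1 Hf p Hp)) as
      [x [y [Hx [_ ->]]]].
    exists x; split; [assumption|f_equal].
    destruct (proj2 Hf x Hx) as [z [_ U]].
    rewrite <- (U y Hp); apply U, is_fun_app, Hx.
  - intros [x [Hx ->]]; now apply is_fun_app.
Qed.
End IsFun.

Lemma graph_is_fun F a b : (forall x, x ∈ a -> F x ∈ b) -> is_fun (graph a F) a b.
Proof.
  intro H; split.
  - intros p Hp; apply mem_graph in Hp; destruct Hp as [x [Hx ->]].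
    apply opair_prod; auto.
  - intros x Hx; exists (F x); split; [now apply opair_graph|].
    intros y Hy; now apply opair_graph in Hy.
Qed.

Lemma mem_Vr a x : x ∈ Vr a <-> exists b, b ∈ a /\ x ⊆ Vr b.
Proof.
  rewrite Vr_eq, mem_union; split.
  - intros [y [Hy Hx]]; apply mem_image in Hy; destruct Hy as [b [Hb <-]].
    exists b; split; [assumption|].
    exact (proj1 (mem_power _ _) Hx).
  - intros [b [Hb Hx]]; exists (power (Vr b)).
    split; [|exact (proj2 (mem_power _ _) Hx)].
    apply mem_image; eauto.
Qed.

Lemma Vr_transitive a : transitive (Vr a).
Proof.
  induction (mem_wf a) as [a _ IH]; intros x y Hx Hy.
  apply mem_Vr in Hx; destruct Hx as [b [Hb Hx]].
  apply mem_Vr; exists b; split; [assumption|].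
  intros z Hz; apply (IH b Hb y z); auto.
Qed.

Lemma mem_Vr_trans x y a : x ∈ y -> y ∈ Vr a -> x ∈ Vr a.
Proof. intros H K; exact (Vr_transitive a y x K H). Qed.

Lemma Vr_down a x y : x ∈ Vr a -> y ⊆ x -> y ∈ Vr a.
Proof.
  rewrite !mem_Vr; intros [b [Hb Hx]] H; exists b; split; auto.
  intros z Hz; auto.
Qed.

(** [Vr x] depends only on the rank of [x]; inclusion in a level is the way to
    compare ranks without ordinals. *)
Lemma Vr_sub x a : x ⊆ Vr a -> Vr x ⊆ Vr a.
Proof.
  revert a; induction (mem_wf x) as [x _ IH]; intros a H y Hy.
  apply mem_Vr in Hy; destruct Hy as [b [Hb Hy]].
  destruct (proj1 (mem_Vr _ _) (H b Hb)) as [c [Hc Hbc]].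
  apply mem_Vr; exists c; split; [assumption|].
  intros z Hz; apply (IH b Hb c); auto.
Qed.

Lemma sub_Vr x : x ⊆ Vr x.
Proof.
  induction (mem_wf x) as [x _ IH]; intros y Hy; apply mem_Vr.
  exists y; split; [assumption | now apply IH].
Qed.

Lemma Vr_mono a b : a ⊆ b -> Vr a ⊆ Vr b.
Proof. intro H; apply Vr_sub; intros x Hx; apply sub_Vr; auto. Qed.

Lemma Vr_idem a : Vr (Vr a) = Vr a.
Proof. apply sub_antisym; apply Vr_sub; [easy|]; intros x Hx; now apply sub_Vr, sub_Vr. Qed.

Lemma Vr_mem_Vr x a : x ∈ Vr a -> Vr x ∈ Vr a.
Proof.
  rewrite !mem_Vr; intros [b [Hb Hx]]; exists b; split; auto; now apply Vr_sub.
Qed.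

Lemma mem_Vr_succ a x : x ∈ Vr (succ a) <-> x ⊆ Vr a.
Proof.
  rewrite mem_Vr; split.
  - intros [b [Hb Hx]]; apply mem_succ in Hb; destruct Hb as [Hb| ->]; [|auto].
    intros z Hz; apply (mem_Vr_trans z (Vr b)); [auto|].
    now apply Vr_mem_Vr, sub_Vr.
  - intro H; exists a; split; [apply mem_succ; auto|auto].
Qed.

Lemma ordinal_mem a x : ordinal a -> x ∈ a -> ordinal x.
Proof.
  intros [Ta Ha] Hx; split; [auto|].
  intros y Hy; apply Ha; now apply (Ta x y).
Qed.

Lemma ordinal_trichotomy a b : ordinal a -> ordinal b -> a ∈ b \/ a = b \/ b ∈ a.
Proof.
  revert b; induction (mem_wf a) as [a _ IHa]; intros b; 
    induction (mem_wf b) as [b _ IHb]; intros Ha Hb.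
  destruct (classic (exists x, x ∈ a /\ ~ x ∈ b)) as [[x [Hx Hn]]|Hab].
  - destruct (IHa x Hx b (ordinal_mem _ _ Ha Hx) Hb) as [H|[H|H]].
    + contradiction.
    + subst x; auto.
    + right; right; exact (proj1 Ha x b Hx H).
  - destruct (classic (exists y, y ∈ b /\ ~ y ∈ a)) as [[y [Hy Hn]]|Hba].
    + destruct (IHb y Hy Ha (ordinal_mem _ _ Hb Hy)) as [H|[H|H]].
      * left; exact (proj1 Hb y a Hy H).
      * subst y; auto.
      * contradiction.
    + right; left; apply sub_antisym; intros z Hz; apply NNPP; intro Hn;
        [apply Hab | apply Hba]; now exists z.
Qed.

Lemma ordinal_sub a b : ordinal a -> ordinal b -> (a ⊆ b <-> a ∈ b \/ a = b).
Proof.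
  intros Ha Hb; split.
  - intro H; destruct (ordinal_trichotomy a b Ha Hb) as [K|[K|K]]; auto.
    destruct (mem_irrefl b (H b K)).
  - intros [H| ->]; [|easy]; intros x Hx; exact (proj1 Hb a x H Hx).
Qed.

Lemma ordinal_total a b : ordinal a -> ordinal b -> b ∈ a \/ a ⊆ b.
Proof.
  intros Ha Hb; destruct (ordinal_trichotomy a b Ha Hb) as [K|[K|K]]; auto;
    right; apply ordinal_sub; auto.
Qed.

Lemma ordinal_Vr a b : ordinal a -> ordinal b -> a ∈ Vr b -> a ∈ b.
Proof.
  intros Ha Hb H; destruct (ordinal_total b a Hb Ha) as [K|K]; [assumption|].
  apply Vr_mem_Vr in H.
  destruct (mem_irrefl (Vr a)); now apply (Vr_mono b a).
Qed.

Lemma succ_sub a b : ordinal b -> a ∈ b -> succ a ⊆ b.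
Proof.
  intros Hb H x Hx; apply mem_succ in Hx; destruct Hx as [Hx| ->]; auto.
  exact (proj1 Hb a x H Hx).
Qed.

(** ** Closure properties of a limit level *)

Section LimitLevel.
Variable l : vset.
Hypothesis Hl : limit_ordinal l.

Let Ol : ordinal l := proj1 Hl.

Lemma limit_level x : x ∈ Vr l <-> exists a, a ∈ l /\ x ∈ Vr a.
Proof.
  split.
  - intro H; apply mem_Vr in H; destruct H as [a [Ha Hx]].
    exists (succ a); split; [now apply Hl|]; now apply mem_Vr_succ.
  - intros [a [Ha Hx]]; apply (Vr_mono a l); [|assumption].
    apply ordinal_sub; auto; exact (ordinal_mem _ _ Ol Ha).
Qed.

Lemma limit_bound2 a b : a ∈ l -> b ∈ l -> exists c, c ∈ l /\ a ⊆ c /\ b ⊆ c.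
Proof.
  intros Ha Hb; pose proof (ordinal_mem _ _ Ol Ha) as Oa.
  pose proof (ordinal_mem _ _ Ol Hb) as Ob.
  destruct (ordinal_total a b Oa Ob) as [H|H].
  - exists a; repeat split; auto; [easy|]; apply ordinal_sub; auto.
  - exists b; repeat split; auto; easy.
Qed.

Lemma limit_level2 x y :
  x ∈ Vr l -> y ∈ Vr l -> exists a, a ∈ l /\ x ∈ Vr a /\ y ∈ Vr a.
Proof.
  intros Hx Hy; apply limit_level in Hx, Hy.
  destruct Hx as [a [Ha Hx]], Hy as [b [Hb Hy]].
  destruct (limit_bound2 a b Ha Hb) as [c [Hc [Hac Hbc]]].
  exists c; split; [assumption|]; split;
    [now apply (Vr_mono a c) | now apply (Vr_mono b c)].
Qed.

Lemma limit_sub x a : a ∈ l -> x ⊆ Vr a -> x ∈ Vr l.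
Proof. intros Ha Hx; apply mem_Vr; eauto. Qed.

Lemma limit_power x : x ∈ Vr l -> power x ∈ Vr l.
Proof.
  intro H; apply mem_Vr in H; destruct H as [a [Ha Hx]].
  apply (limit_sub _ (succ a)); [now apply Hl|].
  intros y Hy; rewrite mem_power in Hy; apply mem_Vr_succ; intros z Hz; auto.
Qed.

Lemma limit_upair x y : x ∈ Vr l -> y ∈ Vr l -> upair x y ∈ Vr l.
Proof.
  intros Hx Hy; destruct (limit_level2 x y Hx Hy) as [a [Ha [Hxa Hya]]].
  apply (limit_sub _ a Ha); intros z Hz; apply mem_upair in Hz.
  destruct Hz; now subst z.
Qed.

Lemma limit_sing x : x ∈ Vr l -> sing x ∈ Vr l.
Proof. intro H; now apply limit_upair. Qed.

Lemma limit_opair x y : x ∈ Vr l -> y ∈ Vr l -> opair x y ∈ Vr l.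
Proof. intros Hx Hy; apply limit_upair; [apply limit_sing|apply limit_upair]; auto. Qed.

Lemma limit_cup x y : x ∈ Vr l -> y ∈ Vr l -> cup x y ∈ Vr l.
Proof.
  intros Hx Hy; destruct (limit_level2 x y Hx Hy) as [a [Ha [Hxa Hya]]].
  apply (limit_sub _ a Ha); intros z Hz; apply mem_cup in Hz.
  destruct Hz as [Hz|Hz]; [apply (mem_Vr_trans _ x)|apply (mem_Vr_trans _ y)]; auto.
Qed.

Lemma limit_prod x y : x ∈ Vr l -> y ∈ Vr l -> prod x y ∈ Vr l.
Proof.
  intros Hx Hy.
  apply (Vr_down _ (power (power (cup x y)))).
  - now apply limit_power, limit_power, limit_cup.
  - intros p Hp; apply mem_prod in Hp; destruct Hp as [u [v [Hu [Hv ->]]]].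
    apply mem_power; intros q Hq; apply mem_power; intros z Hz.
    apply mem_cup; apply mem_upair in Hq; destruct Hq; subst q.
    + apply mem_sing in Hz; subst z; auto.
    + apply mem_upair in Hz; destruct Hz; subst z; auto.
Qed.

Lemma limit_Vr a : a ∈ l -> Vr a ∈ Vr l.
Proof. intro Ha; now apply Vr_mem_Vr, sub_Vr. Qed.

Lemma limit_ordinal_mem a : ordinal a -> (a ∈ Vr l <-> a ∈ l).
Proof.
  intro Ha; split; [now apply ordinal_Vr | apply sub_Vr].
Qed.

Lemma limit_bound_seq (v : nat -> vset) N :
  (forall n, v n ∈ Vr l) -> exists a, a ∈ l /\ forall n, n < N -> v n ∈ Vr a.
Proof.
  intro Hv; induction N as [|N IHN].
  - destruct (proj1 (proj2 Hl)) as [a Ha]; exists a; split; [assumption|lia].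
  - destruct IHN as [a [Ha IH]].
    destruct (proj1 (limit_level _) (Hv N)) as [b [Hb Hvb]].
    destruct (limit_bound2 a b Ha Hb) as [c [Hc [Hac Hbc]]].
    exists c; split; [assumption|]; intros n Hn.
    destruct (Nat.eq_dec n N) as [->|Hne]; [now apply (Vr_mono b c)|].
    apply (Vr_mono a c); [assumption|]; apply IH; lia.
Qed.
End LimitLevel.

(** * Bounded predicates *)

Definition assignment : Type := nat -> vset.

(** Predicates on assignments built from [x ∈ y] and [y = Vr x] by connectives
    and bounded quantifiers.  The latter is an atom because embeddings have to
    commute with the hierarchy, while power sets are not definable by bounded
    quantifiers from membership alone. *)
Inductive bounded : (assignment -> Prop) -> Prop :=
  | bounded_mem m n : bounded (fun v => v m ∈ v n)
  | bounded_Vr m n : bounded (fun v => v m = Vr (v n))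
  | bounded_not Q : bounded Q -> bounded (fun v => ~ Q v)
  | bounded_and Q R : bounded Q -> bounded R -> bounded (fun v => Q v /\ R v)
  | bounded_ball n Q :
      bounded Q -> bounded (fun v => forall x, x ∈ v n -> Q (scons x v)).

Lemma bounded_ext (Q R : assignment -> Prop) :
  (forall v, Q v <-> R v) -> bounded Q -> bounded R.
Proof.
  intros H; replace R with Q; [easy|].
  extensionality v; now apply propositional_extensionality.
Qed.

Lemma scons_eta (v : assignment) : scons (v 0) (fun n => v (S n)) = v.
Proof. extensionality n; now destruct n. Qed.

Lemma scons_rename x (v : assignment) s :
  (fun n => scons x v (match n with 0 => 0 | S n => S (s n) end))
  = scons x (fun n => v (s n)).
Proof. extensionality n; now destruct n. Qed.

Lemma bounded_rename Q (s : nat -> nat) :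
  bounded Q -> bounded (fun v => Q (fun n => v (s n))).
Proof.
  intro H; revert s; induction H as [m n|m n|Q _ IH|Q R _ IHQ _ IHR|n Q _ IH]; intro s.
  - apply bounded_mem.
  - apply bounded_Vr.
  - now apply (bounded_not (fun v => Q (fun n => v (s n)))).
  - now apply (bounded_and (fun v => Q (fun n => v (s n)))
                 (fun v => R (fun n => v (s n)))).
  - specialize (IH (fun n => match n with 0 => 0 | S n => S (s n) end)).
    apply (bounded_ball (s n)) in IH; revert IH; apply bounded_ext; intro v.
    split; intros K x Hx; specialize (K x Hx); now rewrite scons_rename in *.
Qed.

Definition agree_below N (v w : assignment) : Prop := forall i, i < N -> v i = w i.

Lemma bounded_support Q :
  bounded Q -> exists N, forall v w, agree_below N v w -> (Q v <-> Q w).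
Proof.
  intro H; induction H as [m n|m n|Q _ [N IH]|Q R _ [N IHQ] _ [K IHR]|n Q _ [N IH]].
  - exists (S (m + n)); intros v w H; rewrite (H m), (H n) by lia; easy.
  - exists (S (m + n)); intros v w H; rewrite (H m), (H n) by lia; easy.
  - exists N; intros v w H; now rewrite (IH v w H).
  - exists (N + K); intros v w H; rewrite (IHQ v w), (IHR v w); [easy| |];
      intros i Hi; apply H; lia.
  - exists (S (n + N)); intros v w H; rewrite (H n) by lia.
    split; intros L x Hx; apply (IH (scons x v) (scons x w)); auto;
      intros [|i] Hi; simpl; auto; apply H; lia.
Qed.

(** ** Derived connectives and notions *)

(** The quantifier rules are stated for predicates [Q x v] so that higher-order
    unification finds [Q] by abstracting the bound variable. *)
Lemma bounded_all n (Q : vset -> assignment -> Prop) :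
  bounded (fun w => Q (w 0) (fun i => w (S i))) ->
  bounded (fun v => forall x, x ∈ v n -> Q x v).
Proof. exact (bounded_ball n _). Qed.

Lemma bounded_imp Q R :
  bounded Q -> bounded R -> bounded (fun v => Q v -> R v).
Proof.
  intros HQ HR; apply (bounded_ext (fun v => ~ (Q v /\ ~ R v))).
  - intro v; split; [intros H K; apply NNPP|]; tauto.
  - apply (bounded_not (fun v => Q v /\ ~ R v)), bounded_and; [|apply bounded_not]; auto.
Qed.

Lemma bounded_or Q R :
  bounded Q -> bounded R -> bounded (fun v => Q v \/ R v).
Proof.
  intros HQ HR; apply (bounded_ext (fun v => ~ Q v -> R v)).
  - intro v; destruct (classic (Q v)); tauto.
  - apply (bounded_imp (fun v => ~ Q v) R); [apply bounded_not|]; auto.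
Qed.

Lemma bounded_iff Q R :
  bounded Q -> bounded R -> bounded (fun v => Q v <-> R v).
Proof. intros HQ HR; apply bounded_and; now apply bounded_imp. Qed.

Lemma bounded_ex n (Q : vset -> assignment -> Prop) :
  bounded (fun w => Q (w 0) (fun i => w (S i))) ->
  bounded (fun v => exists x, x ∈ v n /\ Q x v).
Proof.
  intro H; apply (bounded_ext (fun v => ~ forall x, x ∈ v n -> ~ Q x v)).
  - intro v; split.
    + intro K; apply NNPP; intro L; apply K; intros x Hx HQ; apply L; eauto.
    + intros [x [Hx HQ]] K; now apply (K x).
  - apply (bounded_not (fun v => forall x, x ∈ v n -> ~ Q x v)), bounded_all.
    now apply (bounded_not (fun w => Q (w 0) (fun i => w (S i)))).
Qed.

Ltac bounded_step :=
  cbn beta;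
  first
    [ assumption
    | apply bounded_mem | apply bounded_Vr
    | solve [eauto 1 with bounded]
    | apply bounded_all | apply bounded_ex
    | apply bounded_not | apply bounded_and | apply bounded_or
    | apply bounded_iff | apply bounded_imp ].
Ltac bounded := repeat bounded_step.

Create HintDb bounded.

Lemma bounded_sub m n : bounded (fun v => v m ⊆ v n).
Proof. unfold sub; bounded. Qed.
#[local] Hint Resolve bounded_sub : bounded.

Lemma bounded_eq m n : bounded (fun v => v m = v n).
Proof.
  apply (bounded_ext (fun v => v m ⊆ v n /\ v n ⊆ v m)); [|bounded].
  intro v; split; [intros [H K]; now apply sub_antisym | intros ->; easy].
Qed.
#[local] Hint Resolve bounded_eq : bounded.

Lemma upair_spec z x y :
  z = upair x y <-> (x ∈ z /\ y ∈ z) /\ forall t, t ∈ z -> t = x \/ t = y.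
Proof.
  split.
  - intros ->; split; [split; apply mem_upair; auto|]; intros t Ht; now apply mem_upair.
  - intros [[Hx Hy] H]; apply vset_ext; intro t; rewrite mem_upair; split; [auto|].
    intros [-> | ->]; auto.
Qed.

Lemma bounded_upair k m n : bounded (fun v => v k = upair (v m) (v n)).
Proof.
  apply (bounded_ext (fun v => (v m ∈ v k /\ v n ∈ v k) /\
           forall t, t ∈ v k -> t = v m \/ t = v n)); [|bounded].
  intro v; now rewrite upair_spec.
Qed.
#[local] Hint Resolve bounded_upair : bounded.

Lemma bounded_sing k m : bounded (fun v => v k = sing (v m)).
Proof. apply bounded_upair. Qed.
#[local] Hint Resolve bounded_sing : bounded.

Lemma bounded_opair k m n : bounded (fun v => v k = opair (v m) (v n)).
Proof.
  apply (bounded_ext (fun v =>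
    (exists a, a ∈ v k /\ exists b, b ∈ v k /\
       a = sing (v m) /\ b = upair (v m) (v n)) /\
    forall t, t ∈ v k -> t = sing (v m) \/ t = upair (v m) (v n))); [|bounded].
  intro v; unfold opair; rewrite upair_spec; split.
  - intros [[a [Ha [b [Hb [-> ->]]]]] H]; auto.
  - intros [[Ha Hb] H]; split; [|assumption].
    exists (sing (v m)); split; [assumption|]; eauto.
Qed.
#[local] Hint Resolve bounded_opair : bounded.

Lemma bounded_opair_mem m n k : bounded (fun v => opair (v m) (v n) ∈ v k).
Proof.
  apply (bounded_ext (fun v => exists p, p ∈ v k /\ p = opair (v m) (v n)));
    [|bounded].
  intro v; split; [intros [p [Hp ->]] | intro H; eexists]; eauto.
Qed.
#[local] Hint Resolve bounded_opair_mem : bounded.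

Lemma bounded_ordinal m : bounded (fun v => ordinal (v m)).
Proof.
  apply (bounded_ext (fun v => (forall x, x ∈ v m -> x ⊆ v m) /\
    forall x, x ∈ v m -> forall y, y ∈ x -> y ⊆ x)); [|bounded].
  intro v; unfold ordinal, transitive, sub; split; intros [H K]; split; eauto.
Qed.
#[local] Hint Resolve bounded_ordinal : bounded.

Lemma bounded_cap k m n : bounded (fun v => v k = cap (v m) (v n)).
Proof.
  apply (bounded_ext (fun v => (forall x, x ∈ v k -> x ∈ v m /\ x ∈ v n) /\
    forall x, x ∈ v m -> x ∈ v n -> x ∈ v k)); [|bounded].
  intro v; split.
  - intros [H K]; apply vset_ext; intro x; rewrite mem_cap; split; [auto|].
    intros [? ?]; auto.
  - intros ->; split; intros x; rewrite mem_cap; auto.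
Qed.
#[local] Hint Resolve bounded_cap : bounded.

Lemma bounded_succ k m : bounded (fun v => v k = succ (v m)).
Proof.
  apply (bounded_ext (fun v => v m ∈ v k /\ v m ⊆ v k /\
    forall x, x ∈ v k -> x ∈ v m \/ x = v m)); [|bounded].
  intro v; split.
  - intros [H [K L]]; apply vset_ext; intro x; rewrite mem_succ; split; [auto|].
    intros [Hx| ->]; auto.
  - intros ->; repeat split.
    + apply mem_succ; auto.
    + intros x Hx; apply mem_succ; auto.
    + intros x Hx; now apply mem_succ.
Qed.
#[local] Hint Resolve bounded_succ : bounded.

(** [inapp g x y] says [y ∈ g(x)] with all quantifiers bounded by [g]. *)
Definition inapp (g x y : vset) : Prop :=
  exists p, p ∈ g /\ exists u, u ∈ p /\ exists z, z ∈ u /\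
    (p = opair x z /\ y ∈ z).

Lemma inapp_graph a F x y : x ∈ a -> (inapp (graph a F) x y <-> y ∈ F x).
Proof.
  intro Hx; split.
  - intros [p [Hp [u [Hu [z [Hz [-> Hy]]]]]]]; apply opair_graph in Hp.
    destruct Hp; now subst.
  - intro Hy; exists (opair x (F x)); split; [now apply opair_graph|].
    exists (upair x (F x)); split; [unfold opair; apply mem_upair; auto|].
    exists (F x); split; [apply mem_upair; auto|auto].
Qed.

Lemma bounded_inapp k m n : bounded (fun v => inapp (v k) (v m) (v n)).
Proof. unfold inapp; bounded. Qed.
#[local] Hint Resolve bounded_inapp : bounded.

(** ** Quantification over assignments related by a set function *)

(** [closure N a b g Q] quantifies [N] pairs [(x, y)] with [x ∈ a], [y ∈ b] and
    [opair x y ∈ g]; the indices [a], [b], [g] shift by two with each pair. *)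
Fixpoint closure (N a b g : nat) (Q : assignment -> Prop) : assignment -> Prop :=
  match N with
  | 0 => Q
  | S N => fun w => forall x, x ∈ w a -> forall y, y ∈ w b ->
      opair x y ∈ w g ->
      closure N (S (S a)) (S (S b)) (S (S g)) Q (scons y (scons x w))
  end.

Lemma bounded_closure N a b g Q : bounded Q -> bounded (closure N a b g Q).
Proof.
  intro H; revert a b g; induction N as [|N IH]; intros a b g; [exact H|]; simpl.
  apply bounded_all; cbn beta.
  apply (bounded_all (S b) (fun y w => opair (w 0) y ∈ w (S g) ->
    closure N (S (S a)) (S (S b)) (S (S g)) Q (scons y (scons (w 0) (fun i => w (S i)))))).
  cbn beta; apply bounded_imp; [apply bounded_opair_mem|].
  apply (bounded_ext (closure N (S (S a)) (S (S b)) (S (S g)) Q)); [|apply IH].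
  intro w; rewrite (scons_eta (fun i => w (S i))), scons_eta; easy.
Qed.

(** The assignment at which [closure N] evaluates its predicate when the pairs
    quantified are [(v i, v' i)]: the last pair comes first. *)
Fixpoint interleave (N : nat) (v v' w : assignment) : assignment :=
  match N with
  | 0 => w
  | S N => interleave N (fun i => v (S i)) (fun i => v' (S i))
             (scons (v' 0) (scons (v 0) w))
  end.

Lemma interleave_base N v v' w i : interleave N v v' w (2 * N + i) = w i.
Proof.
  revert v v' w i; induction N as [|N IH]; intros v v' w i; [reflexivity|].
  cbn [interleave]; replace (2 * S N + i) with (2 * N + S (S i)) by lia.
  now rewrite IH.
Qed.

Lemma interleave_left N v v' w i :
  i < N -> interleave N v v' w (2 * (N - 1 - i) + 1) = v i.
Proof.
  revert v v' w i; induction N as [|N IH]; intros v v' w i Hi; [lia|].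
  cbn [interleave]; destruct i as [|i].
  - replace (2 * (S N - 1 - 0) + 1) with (2 * N + 1) by lia.
    now rewrite interleave_base.
  - replace (S N - 1 - S i) with (N - 1 - i) by lia; rewrite IH by lia; easy.
Qed.

Lemma interleave_right N v v' w i :
  i < N -> interleave N v v' w (2 * (N - 1 - i)) = v' i.
Proof.
  revert v v' w i; induction N as [|N IH]; intros v v' w i Hi; [lia|].
  cbn [interleave]; destruct i as [|i].
  - replace (2 * (S N - 1 - 0)) with (2 * N + 0) by lia.
    now rewrite interleave_base.
  - replace (S N - 1 - S i) with (N - 1 - i) by lia; rewrite IH by lia; easy.
Qed.

Lemma closure_spec N a b g Q w :
  closure N a b g Q w <->
  forall v v', (forall i, i < N ->
      v i ∈ w a /\ v' i ∈ w b /\ opair (v i) (v' i) ∈ w g) ->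
    Q (interleave N v v' w).
Proof.
  revert a b g w; induction N as [|N IH]; intros a b g w; simpl.
  - split; [auto|]; intro H; apply (H w w); lia.
  - split.
    + intros H v v' Hv; destruct (Hv 0) as [H1 [H2 H3]]; [lia|].
      specialize (H _ H1 _ H2 H3); rewrite IH in H; apply H.
      intros i Hi; apply Hv; lia.
    + intros H x Hx y Hy Hp; rewrite IH; intros v v' Hv.
      apply (H (scons x v) (scons y v')).
      intros [|i] Hi; simpl; [auto|]; apply Hv; lia.
Qed.

(** * Elementary embeddings preserve bounded predicates *)

Section Definability.
Variable l : vset.
Let M : vset := Vr l.

Definition definable (Q : assignment -> Prop) : Prop :=
  exists p, forall v, (forall n, v n ∈ M) -> (sat M v p <-> Q v).

Lemma definable_ext (Q R : assignment -> Prop) :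
  (forall v, (forall n, v n ∈ M) -> (Q v <-> R v)) -> definable Q -> definable R.
Proof. intros H [p Hp]; exists p; intros v Hv; now rewrite Hp, H. Qed.

Lemma definable_mem m n : definable (fun v => v m ∈ v n).
Proof. now exists (FMem m n). Qed.

Lemma definable_not Q : definable Q -> definable (fun v => ~ Q v).
Proof. intros [p Hp]; exists (FNot p); intros v Hv; simpl; now rewrite Hp. Qed.

Lemma definable_and Q R :
  definable Q -> definable R -> definable (fun v => Q v /\ R v).
Proof.
  intros [p Hp] [q Hq]; exists (FAnd p q); intros v Hv; simpl; now rewrite Hp, Hq.
Qed.

Lemma definable_imp Q R :
  definable Q -> definable R -> definable (fun v => Q v -> R v).
Proof.
  intros HQ HR; apply (definable_ext (fun v => ~ (Q v /\ ~ R v))).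
  - intros v _; split; [intros H K; apply NNPP|]; tauto.
  - apply (definable_not (fun v => Q v /\ ~ R v)), definable_and; [|apply definable_not]; auto.
Qed.

Lemma definable_iff Q R :
  definable Q -> definable R -> definable (fun v => Q v <-> R v).
Proof. intros HQ HR; apply definable_and; now apply definable_imp. Qed.

Lemma definable_all (Q : vset -> assignment -> Prop) :
  definable (fun w => Q (w 0) (fun i => w (S i))) ->
  definable (fun v => forall x, x ∈ M -> Q x v).
Proof.
  intros [p Hp]; exists (FAll p); intros v Hv; simpl.
  split; intros H x Hx; specialize (H x Hx).
  - rewrite Hp in H; [exact H|]; intros [|n]; simpl; auto.
  - rewrite Hp; [exact H|]; intros [|n]; simpl; auto.
Qed.

Lemma definable_ball n (Q : vset -> assignment -> Prop) :
  definable (fun w => Q (w 0) (fun i => w (S i))) ->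
  definable (fun v => forall x, x ∈ v n -> Q x v).
Proof.
  intro H; apply (definable_ext (fun v => forall x, x ∈ M -> x ∈ v n -> Q x v)).
  - intros v Hv; split; intros K x Hx; [|auto].
    apply K; [|assumption]; now apply (mem_Vr_trans x (v n)).
  - apply (definable_all (fun x v => x ∈ v n -> Q x v)), definable_imp; [|easy].
    apply definable_mem.
Qed.

Lemma definable_ex (Q : vset -> assignment -> Prop) :
  definable (fun w => Q (w 0) (fun i => w (S i))) ->
  definable (fun v => exists x, x ∈ M /\ Q x v).
Proof.
  intro H; apply (definable_ext (fun v => ~ forall x, x ∈ M -> ~ Q x v)).
  - intros v _; split.
    + intro K; apply NNPP; intro L; apply K; intros x Hx HQ; apply L; eauto.
    + intros [x [Hx HQ]] K; now apply (K x).
  - apply (definable_not (fun v => forall x, x ∈ M -> ~ Q x v)), definable_all.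
    now apply (definable_not (fun w => Q (w 0) (fun i => w (S i)))).
Qed.

Ltac definable :=
  repeat (cbn beta; first
    [ assumption | apply definable_mem
    | apply definable_all | apply definable_ex | apply definable_ball
    | apply definable_not | apply definable_and
    | apply definable_iff | apply definable_imp ]).

(** A set of levels in which each is determined by the earlier ones.  Histories
    describe the hierarchy without ordinals or functions: a level is the set of
    all subsets of the members of a history. *)
Definition history (h : vset) : Prop :=
  forall v, v ∈ h -> forall x, x ∈ M ->
    (x ∈ v <-> exists w, w ∈ M /\ (w ∈ h /\ w ∈ v /\ forall z, z ∈ x -> z ∈ w)).

Definition level (y : vset) : Prop :=
  exists h, h ∈ M /\ (history h /\ forall x, x ∈ M ->
    (x ∈ y <-> exists w, w ∈ M /\ (w ∈ h /\ forall z, z ∈ x -> z ∈ w))).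

Lemma level_spec y : y ∈ M -> (level y <-> Vr y = y).
Proof.
  intro Hy; split.
  - intros [h [Hh [Hist Hl]]].
    assert (Hlev : forall v, v ∈ h -> Vr v = v).
    { intro v; induction (mem_wf v) as [v _ IH]; intro Hv.
      assert (E : v = Vr (cap v h)).
      { apply vset_ext; intro x; rewrite mem_Vr.
        assert (HvM : v ∈ M) by (apply (mem_Vr_trans v h); auto).
        split.
        - intro Hx; apply (Hist v Hv) in Hx; [|apply (mem_Vr_trans x v); auto].
          destruct Hx as [w [_ [Hw [Hwv Hx]]]]; exists w; rewrite mem_cap.
          split; [auto|]; now rewrite (IH w Hwv Hw).
        - intros [w [Hw Hx]]; apply mem_cap in Hw; destruct Hw as [Hwv Hw].
          rewrite (IH w Hwv Hw) in Hx.
          assert (HwM : w ∈ M) by (apply (mem_Vr_trans w v); auto).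
          apply (Hist v Hv); [now apply (Vr_down _ w)|].
          exists w; auto. }
      rewrite E; apply Vr_idem. }
    assert (E : y = Vr h); [|rewrite E; apply Vr_idem].
    apply vset_ext; intro x; rewrite mem_Vr; split.
    + intro Hx; apply Hl in Hx; [|apply (mem_Vr_trans x y); auto].
      destruct Hx as [w [_ [Hw Hx]]]; exists w; now rewrite (Hlev w Hw).
    + intros [w [Hw Hx]]; rewrite (Hlev w Hw) in Hx.
      assert (HwM : w ∈ M) by (apply (mem_Vr_trans w h); auto).
      apply Hl; [now apply (Vr_down _ w)|]; exists w; auto.
  - intro E.
    assert (Hsub : forall v, Vr v = v -> forall x,
      x ∈ v <-> exists w, (w ∈ v /\ Vr w = w) /\ x ⊆ w).
    { intros v Ev x; split.
      - rewrite <- Ev at 1; intro Hx; apply mem_Vr in Hx; destruct Hx as [b [Hb Hx]].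
        exists (Vr b); repeat split; [|apply Vr_idem|assumption].
        rewrite <- Ev; now apply Vr_mem_Vr; rewrite Ev.
      - intros [w [[Hw Ew] Hx]]; rewrite <- Ev; apply mem_Vr.
        exists w; split; [assumption|]; now rewrite Ew. }
    exists (sep y (fun w => Vr w = w)); split; [|split].
    + apply (Vr_down _ y); [assumption|]; intros z Hz; now apply mem_sep in Hz.
    + intros v Hv x Hx; apply mem_sep in Hv; destruct Hv as [Hv Ev].
      rewrite (Hsub v Ev); split.
      * intros [w [[Hw Ew] Hxw]]; exists w.
        assert (Hwy : w ∈ y) by (rewrite <- E; apply (Vr_transitive y v); auto;
                                 now rewrite E).
        split; [apply (mem_Vr_trans w y); auto|]; rewrite mem_sep; auto.
      * intros [w [_ [Hw [Hwv Hxw]]]]; apply mem_sep in Hw; exists w; tauto.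
    + intros x Hx; rewrite (Hsub y E); split.
      * intros [w [[Hw Ew] Hxw]]; exists w.
        split; [apply (mem_Vr_trans w y); auto|]; rewrite mem_sep; auto.
      * intros [w [_ [Hw Hxw]]]; apply mem_sep in Hw; exists w; tauto.
Qed.

Lemma Vr_least_level x y : x ∈ M -> y ∈ M ->
  (y = Vr x <-> level y /\ (forall z, z ∈ x -> z ∈ y) /\
     forall u, u ∈ M -> level u -> (forall z, z ∈ x -> z ∈ u) ->
       forall z, z ∈ y -> z ∈ u).
Proof.
  intros Hx Hy; rewrite (level_spec y Hy); split.
  - intros ->; split; [apply Vr_idem|]; split; [apply sub_Vr|].
    intros u Hu Lu Hxu; apply (level_spec u Hu) in Lu; rewrite <- Lu.
    apply Vr_sub; now rewrite Lu.
  - intros [E [Hxy H]]; apply sub_antisym.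
    + intros z Hz; apply (H (Vr x)); auto; [now apply Vr_mem_Vr| |apply sub_Vr].
      apply level_spec; [now apply Vr_mem_Vr | apply Vr_idem].
    + rewrite <- E; apply Vr_sub; now rewrite E.
Qed.

Lemma definable_Vr m n : definable (fun v => v m = Vr (v n)).
Proof.
  apply (definable_ext (fun v => level (v m) /\
    (forall z, z ∈ v n -> z ∈ v m) /\
    forall u, u ∈ M -> level u -> (forall z, z ∈ v n -> z ∈ u) ->
       forall z, z ∈ v m -> z ∈ u)).
  - intros v Hv; now rewrite Vr_least_level.
  - unfold level, history; definable.
Qed.

Lemma bounded_definable Q : bounded Q -> definable Q.
Proof.
  intro H; induction H.
  - apply definable_mem.
  - apply definable_Vr.
  - now apply definable_not.
  - now apply definable_and.
  - apply (definable_ball n (fun x v => Q (scons x v))); cbn beta.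
    revert IHbounded; apply definable_ext; intros v Hv.
    now rewrite scons_eta.
Qed.
End Definability.

(** A weakening of elementarity that a transfer argument proves for [dot l j k]:
    that [k] preserves a given bounded predicate on a given set is a bounded
    statement, to which [j] applies. *)
Definition embedding (l k : vset) : Prop :=
  is_fun k (Vr l) (Vr l) /\
  forall Q, bounded Q -> forall v, (forall n, v n ∈ Vr l) ->
    (Q v <-> Q (fun n => app k (v n))).

Lemma elementary_embedding l k : elementary (Vr l) (Vr l) k -> embedding l k.
Proof.
  intros [Hk He]; split; [exact Hk|]; intros Q HQ v Hv.
  destruct (bounded_definable l Q HQ) as [p Hp].
  rewrite <- (Hp v Hv), (He p v Hv); apply Hp.
  intro n; now apply (is_fun_val k (Vr l) (Vr l)).
Qed.

Lemma idV_app l x : x ∈ Vr l -> app (idV l) x = x.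
Proof. apply app_graph. Qed.

Lemma embedding_idV l : embedding l (idV l).
Proof.
  split; [now apply graph_is_fun|]; intros Q _ v Hv.
  replace (fun n => app (idV l) (v n)) with v; [easy|].
  extensionality n; symmetry; now apply idV_app.
Qed.

Lemma comp_app l j k x : x ∈ Vr l -> app (comp l j k) x = app j (app k x).
Proof. apply (app_graph (Vr l) (fun x => app j (app k x))). Qed.

Lemma embedding_comp l j k :
  embedding l j -> embedding l k -> embedding l (comp l j k).
Proof.
  intros [Fj Hj] [Fk Hk].
  assert (Hv1 : forall x, x ∈ Vr l -> app k x ∈ Vr l) by (apply is_fun_val; auto).
  split.
  - apply graph_is_fun; intros x Hx; apply (is_fun_val j _ _ Fj); auto.
  - intros Q HQ v Hv; rewrite (Hk Q HQ v Hv), (Hj Q HQ) by auto.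
    replace (fun n => app (comp l j k) (v n))
      with (fun n => app j (app k (v n))); [easy|].
    extensionality n; symmetry; now apply comp_app.
Qed.

(** * Application of embeddings *)

Section Embedding.
Variables l k : vset.
Hypothesis Hk : embedding l k.
Let M : vset := Vr l.

Lemma emb_val x : x ∈ M -> app k x ∈ M.
Proof. exact (is_fun_val k M M (proj1 Hk) x). Qed.

Lemma emb_assignment Q v : bounded Q -> (forall n, v n ∈ M) ->
  (Q v <-> Q (fun n => app k (v n))).
Proof. intro HQ; now apply (proj2 Hk Q HQ v). Qed.

Lemma transfer1 (Q : vset -> Prop) x :
  bounded (fun v => Q (v 0)) -> x ∈ M -> (Q x <-> Q (app k x)).
Proof. intros HQ Hx; now apply (emb_assignment _ (fun _ => x) HQ). Qed.

Lemma transfer2 (Q : vset -> vset -> Prop) x y :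
  bounded (fun v => Q (v 0) (v 1)) -> x ∈ M -> y ∈ M ->
  (Q x y <-> Q (app k x) (app k y)).
Proof.
  intros HQ Hx Hy; apply (emb_assignment _ (scons x (fun _ => y)) HQ).
  now intros [|n].
Qed.

Lemma transfer3 (Q : vset -> vset -> vset -> Prop) x y z :
  bounded (fun v => Q (v 0) (v 1) (v 2)) -> x ∈ M -> y ∈ M -> z ∈ M ->
  (Q x y z <-> Q (app k x) (app k y) (app k z)).
Proof.
  intros HQ Hx Hy Hz.
  apply (emb_assignment _ (scons x (scons y (fun _ => z))) HQ).
  now intros [|[|n]].
Qed.

Lemma emb_mem x y : x ∈ M -> y ∈ M -> (x ∈ y <-> app k x ∈ app k y).
Proof. apply (transfer2 mem); bounded. Qed.

Lemma emb_mem_val x y : y ∈ M -> x ∈ y -> app k x ∈ app k y.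
Proof.
  intros Hy H; apply -> emb_mem; auto; now apply (mem_Vr_trans x y).
Qed.

Lemma emb_inj x y : x ∈ M -> y ∈ M -> (x = y <-> app k x = app k y).
Proof. apply (transfer2 eq); bounded. Qed.

Lemma emb_sub x y : x ∈ M -> y ∈ M -> x ⊆ y -> app k x ⊆ app k y.
Proof. intros Hx Hy; apply (transfer2 sub); auto; bounded. Qed.

Lemma emb_Vr x : x ∈ M -> app k (Vr x) = Vr (app k x).
Proof.
  intro Hx; apply (transfer2 (fun x y => y = Vr x) x (Vr x)); auto; [bounded|].
  now apply Vr_mem_Vr.
Qed.

Lemma emb_cap x y : x ∈ M -> y ∈ M -> app k (cap x y) = cap (app k x) (app k y).
Proof.
  intros Hx Hy; apply (transfer3 (fun x y z => z = cap x y) x y (cap x y)); auto;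
    [bounded|].
  apply (Vr_down _ x); auto; intros z Hz; now apply mem_cap in Hz.
Qed.

Lemma emb_succ x : x ∈ M -> succ x ∈ M -> app k (succ x) = succ (app k x).
Proof.
  intros Hx Hs; apply (transfer2 (fun x y => y = succ x) x (succ x)); auto; bounded.
Qed.

Lemma emb_ordinal x : x ∈ M -> ordinal x -> ordinal (app k x).
Proof. intros Hx; apply (transfer1 ordinal); auto; bounded. Qed.

Hypothesis Hl : limit_ordinal l.
Let Ol : ordinal l := proj1 Hl.

Lemma limit_mem_ordinal a : a ∈ l -> ordinal a.
Proof. exact (ordinal_mem l a Ol). Qed.

Lemma emb_limit a : a ∈ l -> app k a ∈ l.
Proof.
  intro Ha; pose proof (limit_mem_ordinal a Ha).
  apply (limit_ordinal_mem l Hl).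
  - apply emb_ordinal; [now apply sub_Vr|assumption].
  - apply emb_val; now apply sub_Vr.
Qed.

Lemma emb_opair x y : x ∈ M -> y ∈ M -> app k (opair x y) = opair (app k x) (app k y).
Proof.
  intros Hx Hy; apply (transfer3 (fun x y z => z = opair x y) x y (opair x y));
    auto; [bounded|].
  now apply limit_opair.
Qed.

(** The least ordinal with [k a ∈ a] would be mapped below itself. *)
Lemma emb_increasing a : a ∈ l -> a ⊆ app k a.
Proof.
  induction (mem_wf a) as [a _ IH]; intro Ha.
  pose proof (limit_mem_ordinal a Ha) as Oa.
  pose proof (limit_mem_ordinal _ (emb_limit a Ha)) as Ok.
  destruct (ordinal_total a (app k a) Oa Ok) as [H|H]; [|assumption].
  assert (Ha' : app k a ∈ M) by (apply sub_Vr, emb_limit, Ha).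
  apply (emb_mem _ _ Ha' (sub_Vr l a Ha)) in H as H'.
  destruct (mem_irrefl (app k (app k a))).
  apply (IH _ H (emb_limit a Ha)), H'.
Qed.

Lemma emb_Vr_increasing a : a ∈ l -> Vr a ⊆ Vr (app k a).
Proof. intro Ha; apply Vr_mono; now apply emb_increasing. Qed.

Lemma limit_graph a : a ∈ M -> graph a (app k) ∈ M.
Proof.
  intro Ha; apply (Vr_down _ (prod a (app k a))).
  - apply limit_prod; auto; now apply emb_val.
  - intros p Hp; apply mem_graph in Hp; destruct Hp as [x [Hx ->]].
    apply opair_prod; split; [assumption|].
    now apply emb_mem_val.
Qed.

Lemma starcap_sub t : starcap k t ⊆ prod (Vr t) (Vr t).
Proof. intros p Hp; exact (proj1 (proj1 (mem_sep _ _ _) Hp)). Qed.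

Lemma limit_starcap t : t ∈ l -> starcap k t ∈ M.
Proof.
  intro Ht; apply (Vr_down _ (prod (Vr t) (Vr t))).
  - apply limit_prod; auto; now apply limit_Vr.
  - apply starcap_sub.
Qed.
End Embedding.

Lemma limit_cup_level l k a : limit_ordinal l -> embedding l k -> a ∈ Vr l ->
  exists b, b ∈ l /\ a ⊆ app k (Vr b).
Proof.
  intros Hl Hk Ha; apply mem_Vr in Ha; destruct Ha as [b [Hb Ha]].
  exists b; split; [assumption|].
  rewrite (emb_Vr l k Hk) by now apply sub_Vr.
  intros x Hx; now apply (emb_Vr_increasing l k Hk Hl), Ha.
Qed.

Lemma emb_ext l k k' : embedding l k -> embedding l k' ->
  (forall x, x ∈ Vr l -> app k x = app k' x) -> k = k'.
Proof.
  intros [Fk _] [Fk' _] H.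
  rewrite (is_fun_graph k _ _ Fk), (is_fun_graph k' _ _ Fk').
  now apply graph_ext.
Qed.

(** ** The embedding [dot l j k] *)

Section Dot.
Variables l j k : vset.
Hypothesis Hl : limit_ordinal l.
Hypothesis Hj : embedding l j.
Hypothesis Hk : embedding l k.
Let M : vset := Vr l.

(** The restriction of [k] to the set [a]; in contrast with [k ∩ V_α] it is a
    function on a prescribed domain, so that [j] sends it to a function. *)
Let res (a : vset) : vset := graph a (app k).

Let res_M a : a ∈ M -> res a ∈ M.
Proof. exact (limit_graph l k Hk Hl a). Qed.

Lemma mem_dot p : p ∈ dot l j k <-> exists a, a ∈ M /\ p ∈ app j (res a).
Proof.
  unfold dot; rewrite mem_union.
  assert (Hcap : forall a, a ∈ l -> cap k (Vr a) ∈ M).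
  { intros a Ha; apply (limit_sub l _ a Ha); intros z Hz; now apply mem_cap in Hz. }
  split.
  - intros [y [Hy Hp]]; apply mem_image in Hy; destruct Hy as [a [Ha <-]].
    assert (HaM : Vr a ∈ M) by now apply limit_Vr.
    exists (Vr a); split; [assumption|]; revert p Hp; apply (emb_sub l j Hj); auto.
    intros p Hp; apply mem_cap in Hp; destruct Hp as [Hp Hpa].
    rewrite (is_fun_graph k _ _ (proj1 Hk)) in Hp; apply mem_graph in Hp.
    destruct Hp as [x [Hx ->]]; apply opair_graph; split; [|reflexivity].
    apply (mem_Vr_trans x (sing x)); [now apply mem_sing|].
    apply (mem_Vr_trans _ (opair x (app k x))); [|assumption].
    apply mem_upair; auto.
  - intros [a [Ha Hp]].
    destruct (proj1 (limit_level l Hl _) (res_M a Ha)) as [b [Hb Hab]].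
    exists (app j (cap k (Vr b))); split; [apply mem_image; eauto|].
    revert p Hp; apply (emb_sub l j Hj); auto; intros p Hp; apply mem_cap; split.
    + apply mem_graph in Hp; destruct Hp as [x [Hx ->]].
      apply (is_fun_app k M M (proj1 Hk)); now apply (mem_Vr_trans x a).
    + now apply (mem_Vr_trans p (res a)).
Qed.

Let res_functional a : a ∈ M ->
  (forall p, p ∈ app j (res a) -> exists x, x ∈ app j a /\
     exists y, y ∈ app j (app k a) /\ p = opair x y) /\
  (forall x, x ∈ app j a -> exists y, y ∈ app j (app k a) /\
     opair x y ∈ app j (res a)) /\
  (forall x, x ∈ app j a -> forall y, y ∈ app j (app k a) ->
     forall z, z ∈ app j (app k a) ->
     opair x y ∈ app j (res a) -> opair x z ∈ app j (res a) -> y = z).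
Proof.
  intro Ha.
  apply (transfer3 l j Hj (fun a b g =>
    (forall p, p ∈ g -> exists x, x ∈ a /\ exists y, y ∈ b /\ p = opair x y) /\
    (forall x, x ∈ a -> exists y, y ∈ b /\ opair x y ∈ g) /\
    (forall x, x ∈ a -> forall y, y ∈ b -> forall z, z ∈ b ->
      opair x y ∈ g -> opair x z ∈ g -> y = z)) a (app k a) (res a)); auto.
  - bounded.
  - now apply (emb_val l k Hk).
  - assert (Hval : forall x, x ∈ a -> app k x ∈ app k a).
    { intros x Hx; now apply (emb_mem_val l k Hk). }
    unfold res; split; [|split].
    + intros p Hp; apply mem_graph in Hp; destruct Hp as [x [Hx ->]].
      exists x; split; [assumption|]; exists (app k x); auto.
    + intros x Hx; exists (app k x); split; [auto|]; now apply opair_graph.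
    + intros x _ y _ z _ Hy Hz; apply opair_graph in Hy, Hz.
      destruct Hy, Hz; now subst.
Qed.

Let dot_functional x y z : opair x y ∈ dot l j k -> opair x z ∈ dot l j k -> y = z.
Proof.
  rewrite !mem_dot; intros [a [Ha Hy]] [b [Hb Hz]].
  assert (Hc : cup a b ∈ M) by now apply limit_cup.
  assert (Hy' : opair x y ∈ app j (res (cup a b))).
  { revert Hy; apply (emb_sub l j Hj); auto; intros p Hp.
    apply mem_graph in Hp; destruct Hp as [u [Hu ->]]; apply opair_graph.
    split; [apply mem_cup|]; auto. }
  assert (Hz' : opair x z ∈ app j (res (cup a b))).
  { revert Hz; apply (emb_sub l j Hj); auto; intros p Hp.
    apply mem_graph in Hp; destruct Hp as [u [Hu ->]]; apply opair_graph.
    split; [apply mem_cup|]; auto. }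
  destruct (res_functional (cup a b) Hc) as [H1 [_ H3]].
  destruct (H1 _ Hy') as [x1 [Hx1 [y1 [Hy1 E1]]]].
  destruct (H1 _ Hz') as [x2 [Hx2 [y2 [Hy2 E2]]]].
  apply opair_inj in E1, E2; destruct E1, E2; subst.
  now apply (H3 x2 Hx2).
Qed.

Lemma dot_is_fun : is_fun (dot l j k) M M.
Proof.
  split.
  - intros p Hp; apply mem_dot in Hp; destruct Hp as [a [Ha Hp]].
    destruct (proj1 (res_functional a Ha) p Hp) as [x [Hx [y [Hy ->]]]].
    assert (HjM : forall b, b ∈ M -> app j b ∈ M) by exact (emb_val l j Hj).
    assert (HkM : forall b, b ∈ M -> app k b ∈ M) by exact (emb_val l k Hk).
    apply opair_prod; split;
      [apply (mem_Vr_trans x (app j a)) | apply (mem_Vr_trans y (app j (app k a)))];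
      auto; apply HjM; auto; now apply HkM.
  - intros x Hx; destruct (limit_level l Hl x) as [H _]; destruct (H Hx) as [b [Hb Hxb]].
    assert (HbM : Vr b ∈ M) by now apply limit_Vr.
    destruct (proj1 (proj2 (res_functional (Vr b) HbM)) x) as [y [Hy Hp]].
    + rewrite (emb_Vr l j Hj) by now apply sub_Vr.
      now apply (emb_Vr_increasing l j Hj Hl).
    + assert (Hd : opair x y ∈ dot l j k) by (apply mem_dot; eauto).
      exists y; split; [assumption|]; intros z Hz; now apply (dot_functional x).
Qed.

(** The property that determines [dot l j k] and lets bounded facts about [k]
    on [a] be transferred by [j]. *)
Lemma app_graph_dot a : a ∈ M ->
  app j (graph a (app k)) = graph (app j a) (app (dot l j k)).
Proof.
  intro Ha; change (graph a (app k)) with (res a); apply vset_ext; intro p.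
  destruct (res_functional a Ha) as [H1 [H2 _]].
  assert (Hd : forall x y, opair x y ∈ app j (res a) -> app (dot l j k) x = y).
  { intros x y Hp; assert (opair x y ∈ dot l j k) by (apply mem_dot; eauto).
    apply app_eq; [assumption|]; intros z Hz; now apply (dot_functional x). }
  rewrite mem_graph; split.
  - intro Hp; destruct (H1 p Hp) as [x [Hx [y [Hy ->]]]].
    exists x; split; [assumption|]; now rewrite (Hd x y).
  - intros [x [Hx ->]]; destruct (H2 x Hx) as [y [Hy Hp]]; now rewrite (Hd x y).
Qed.

Lemma dot_app x : x ∈ M -> app j (app k x) = app (dot l j k) (app j x).
Proof.
  intro Hx; assert (Hs : sing x ∈ M) by now apply limit_sing.
  assert (Hp : app j (opair x (app k x)) ∈ app j (res (sing x))).
  { apply (emb_mem_val l j Hj); auto.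
    apply opair_graph; split; [now apply mem_sing|reflexivity]. }
  unfold res in Hp; rewrite app_graph_dot in Hp by assumption.
  rewrite (emb_opair l j Hj Hl) in Hp; auto; [|now apply (emb_val l k Hk)].
  exact (proj2 (proj1 (opair_graph _ _ _ _) Hp)).
Qed.

(** For a bounded [Q] depending on [N] variables, the statement that [Q v] and
    [Q (k v)] are equivalent for all [v] in [a] is itself bounded in [a], in
    [k a] and in the restriction of [k] to [a], hence preserved by [j]. *)
Lemma embedding_dot : embedding l (dot l j k).
Proof.
  split; [apply dot_is_fun|]; intros Q HQ v Hv.
  destruct (bounded_support Q HQ) as [N HN].
  destruct (limit_bound_seq l Hl v N Hv) as [c [Hc Hvc]].
  assert (Ha : Vr c ∈ M) by now apply limit_Vr.
  assert (Hka : app k (Vr c) ∈ M) by now apply (emb_val l k Hk).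
  set (R := fun u : assignment =>
    Q (fun i => u (2 * (N - 1 - i) + 1)) <-> Q (fun i => u (2 * (N - 1 - i)))).
  assert (HR : bounded R).
  { apply bounded_iff; [apply (bounded_rename Q (fun i => 2 * (N - 1 - i) + 1))
                       |apply (bounded_rename Q (fun i => 2 * (N - 1 - i)))]; auto. }
  assert (HRi : forall v v' w, R (interleave N v v' w) <-> (Q v <-> Q v')).
  { intros u u' w; unfold R.
    rewrite (HN (fun i => interleave N u u' w (2 * (N - 1 - i) + 1)) u)
      by (intros i Hi; now apply interleave_left).
    now rewrite (HN (fun i => interleave N u u' w (2 * (N - 1 - i))) u')
      by (intros i Hi; now apply interleave_right). }
  assert (K : closure N 0 1 2 R
      (scons (Vr c) (scons (app k (Vr c)) (fun _ => res (Vr c))))).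
  { apply closure_spec; intros u u' Hu; simpl in Hu; apply HRi.
    set (t := fun i => if i <? N then u i else Vr c).
    assert (Et : agree_below N t u).
    { intros i Hi; unfold t; now rewrite (proj2 (Nat.ltb_lt i N) Hi). }
    rewrite <- (HN t u Et), (emb_assignment l k Hk Q t HQ).
    - rewrite (HN (fun i => app k (t i)) u'); [easy|].
      intros i Hi; rewrite (Et i Hi); destruct (Hu i Hi) as [_ [_ Hp]].
      now apply opair_graph in Hp.
    - intro i; unfold t; destruct (Nat.ltb_spec i N) as [Hi|Hi]; [|assumption].
      apply (mem_Vr_trans _ (Vr c)); [now apply Hu|assumption]. }
  rewrite (emb_assignment l j Hj _ _ (bounded_closure N 0 1 2 R HR)) in K.
  2: { intros [|[|n]]; simpl; auto. }
  rewrite closure_spec in K; simpl in K; specialize (K v (fun i => app (dot l j k) (v i))).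
  rewrite HRi in K; apply K; intros i Hi.
  assert (Hvi : v i ∈ app j (Vr c)).
  { rewrite (emb_Vr l j Hj) by now apply sub_Vr.
    now apply (emb_Vr_increasing l j Hj Hl), Hvc. }
  assert (Hp : opair (v i) (app (dot l j k) (v i)) ∈ app j (res (Vr c))).
  { unfold res; rewrite app_graph_dot by assumption; now apply opair_graph. }
  split; [assumption|]; split; [|assumption].
  destruct (proj1 (res_functional _ Ha) _ Hp) as [x [Hx [y [Hy E]]]].
  apply opair_inj in E; destruct E; now subst.
Qed.
End Dot.

(** An embedding is determined on the sets [app j (app k (Vr b))], and there
    both sides are [app j] applied to a restriction of [app k]. *)
Lemma dot_distributive l j k m : limit_ordinal l ->
  embedding l j -> embedding l k -> embedding l m ->
  dot l j (dot l k m) = dot l (dot l j k) (dot l j m).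
Proof.
  intros Hl Hj Hk Hm.
  assert (Hkm := embedding_dot l k m Hl Hk Hm).
  assert (Hjk := embedding_dot l j k Hl Hj Hk).
  assert (Hjm := embedding_dot l j m Hl Hj Hm).
  apply (emb_ext l); try now apply embedding_dot.
  intros x Hx.
  destruct (limit_cup_level l _ (sing x) Hl (embedding_comp l j k Hj Hk)) as [b [Hb Hxb]].
  { now apply limit_sing. }
  assert (HbM : Vr b ∈ Vr l) by now apply limit_Vr.
  assert (HkM : app k (Vr b) ∈ Vr l) by now apply (emb_val l k Hk).
  rewrite comp_app in Hxb by assumption.
  specialize (Hxb x (proj2 (mem_sing x x) eq_refl)).
  assert (HjM : app j (Vr b) ∈ Vr l) by now apply (emb_val l j Hj).
  assert (HmM : graph (Vr b) (app m) ∈ Vr l) by now apply (limit_graph l m Hm Hl).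
  assert (E : graph (app j (app k (Vr b))) (app (dot l j (dot l k m)))
            = graph (app j (app k (Vr b))) (app (dot l (dot l j k) (dot l j m)))).
  { rewrite <- (app_graph_dot l j (dot l k m) Hl Hj Hkm) by assumption.
    rewrite <- (app_graph_dot l k m Hl Hk Hm) by assumption.
    rewrite (dot_app l j k Hl Hj Hk (Vr b)) by assumption.
    rewrite <- (app_graph_dot l (dot l j k) (dot l j m) Hl Hjk Hjm) by assumption.
    rewrite <- (app_graph_dot l j m Hl Hj Hm) by assumption.
    now apply (dot_app l j k Hl Hj Hk). }
  rewrite <- (app_graph _ (app (dot l j (dot l k m))) x Hxb), E.
  now apply app_graph.
Qed.

Lemma dot_idV l k : limit_ordinal l -> embedding l k -> dot l (idV l) k = k.
Proof.
  intros Hl Hk; assert (Hi := embedding_idV l).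
  apply (emb_ext l); [now apply embedding_dot|assumption|].
  intros x Hx.
  rewrite <- (idV_app l x Hx) at 1.
  rewrite <- (dot_app l (idV l) k Hl Hi Hk) by assumption.
  apply idV_app; now apply (emb_val l k Hk).
Qed.

Lemma comp_dot l j k : limit_ordinal l -> embedding l j -> embedding l k ->
  comp l j k = comp l (dot l j k) j.
Proof.
  intros Hl Hj Hk; apply graph_ext; intros x Hx; now apply dot_app.
Qed.

(** * Critical points *)

Definition critical (l k c : vset) : Prop := c ∈ l /\ is_crit k c.

Section Critical.
Variable l : vset.
Hypothesis Hl : limit_ordinal l.
Let M : vset := Vr l.

Let lord a : a ∈ l -> ordinal a.
Proof. exact (limit_mem_ordinal l Hl a). Qed.

Lemma critical_unique k c d : critical l k c -> critical l k d -> c = d.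
Proof.
  intros [Hc [Mc Fc]] [Hd [Md Fd]].
  destruct (ordinal_trichotomy c d (lord c Hc) (lord d Hd)) as [H|[H|H]]; auto.
  - now destruct (Mc (Fd c H)).
  - now destruct (Md (Fc d H)).
Qed.

Lemma critical_cr k c : critical l k c -> cr l k = c.
Proof.
  intros [Hc Hk]; apply the_eq; auto.
  intros d Hd Kd; now apply (critical_unique k).
Qed.

Section Embedding.
Variable k : vset.
Hypothesis Hk : embedding l k.

(** A set [x] with [x ⊆ Vr a], where [a] is fixed, gets no new member: it would
    lie in [Vr a], where everything is fixed by induction on [a]. *)
Lemma fixed_level c : ordinal c -> c ⊆ l ->
  (forall a, a ∈ c -> app k a = a) -> forall x, x ∈ Vr c -> app k x = x.
Proof.
  intros Oc Hcl Hfix.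
  assert (K : forall a, a ∈ c -> forall x, x ⊆ Vr a -> app k x = x).
  { intro a; induction (mem_wf a) as [a _ IH]; intros Ha x Hx.
    assert (Hal : a ∈ l) by auto.
    assert (HxM : x ∈ M) by now apply (limit_sub l x a).
    assert (Hfx : forall y, y ∈ Vr a -> app k y = y).
    { intros y Hy; apply mem_Vr in Hy; destruct Hy as [b [Hb Hy]].
      apply (IH b); auto; exact (proj1 Oc a b Ha Hb). }
    apply sub_antisym; intros y Hy.
    - assert (Hya : y ∈ Vr a).
      { rewrite <- (Hfix a Ha), <- (emb_Vr l k Hk) by now apply sub_Vr.
        apply (emb_sub l k Hk) in Hx; auto; now apply limit_Vr. }
      rewrite <- (Hfx y Hya) in Hy.
      apply (emb_mem l k Hk) in Hy; auto.
      apply (mem_Vr_trans y (Vr a)); [assumption|]; now apply limit_Vr.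
    - rewrite <- (Hfx y) by auto; now apply (emb_mem_val l k Hk). }
  intros x Hx; apply mem_Vr in Hx; destruct Hx as [a [Ha Hx]]; eauto.
Qed.

(** An embedding that fixes every ordinal below [l] is the identity. *)
Lemma critical_exists : k <> idV l -> exists c, critical l k c.
Proof.
  intro Hne; apply NNPP; intro Hno; apply Hne.
  apply (emb_ext l k (idV l) Hk (embedding_idV l)); intros x Hx.
  rewrite idV_app by assumption.
  apply (fixed_level l); auto; [apply Hl|easy|].
  intro a; induction (mem_wf a) as [a _ IH]; intro Ha.
  apply NNPP; intro Hm; apply Hno; exists a; split; [assumption|].
  split; [assumption|]; intros b Hb; apply IH; auto.
  exact (proj1 (proj1 Hl) a b Ha Hb).
Qed.

Variable c : vset.
Hypothesis Hc : critical l k c.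

Lemma critical_fixed x : x ∈ Vr c -> app k x = x.
Proof.
  destruct Hc as [Hcl [_ F]]; apply fixed_level; auto.
  apply ordinal_sub; auto; apply Hl.
Qed.

Lemma critical_moved : c ∈ app k c.
Proof.
  destruct Hc as [Hcl [Hm _]].
  destruct (proj1 (ordinal_sub c (app k c) (lord c Hcl)
    (lord _ (emb_limit l k Hk Hl c Hcl))) (emb_increasing l k Hk Hl c Hcl)); auto.
  now destruct Hm.
Qed.

(** [0] and successors of fixed ordinals are fixed. *)
Lemma critical_limit : limit_ordinal c.
Proof.
  pose proof Hc as [Hcl [Hm F]]; pose proof (lord c Hcl) as Oc.
  split; [assumption|]; split.
  - apply NNPP; intro Hno; pose proof critical_moved as K.
    assert (HcM : c ∈ M) by now apply sub_Vr.
    assert (E : forall z, z ∈ app k c -> ~ z ∈ app k c).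
    { apply (transfer1 l k Hk (fun x => forall z, z ∈ x -> ~ z ∈ x) c); auto.
      - bounded.
      - intros z Hz; destruct Hno; eauto. }
    exact (E c K K).
  - intros a Ha.
    assert (Hal : a ∈ l) by exact (proj1 (proj1 Hl) c a Hcl Ha).
    assert (Hsl : succ a ∈ l) by now apply Hl.
    assert (Hs : succ a ⊆ c) by now apply succ_sub.
    destruct (proj1 (ordinal_sub (succ a) c (lord _ Hsl) Oc) Hs) as [H|H]; [assumption|].
    destruct Hm; rewrite <- H.
    rewrite (emb_succ l k Hk) by now apply sub_Vr.
    now rewrite (F a Ha).
Qed.
End Embedding.

(** That [k] is the identity on [c] is a bounded statement about its restriction
    to [c]. *)
Lemma dot_critical j k c : embedding l j -> embedding l k ->
  critical l k c -> critical l (dot l j k) (app j c).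
Proof.
  intros Hj Hk [Hc [Hm F]].
  assert (HcM : c ∈ M) by now apply sub_Vr.
  split; [now apply (emb_limit l j Hj Hl)|]; split.
  - rewrite <- (dot_app l j k Hl Hj Hk) by assumption; intro H; apply Hm.
    apply (emb_inj l j Hj); auto; now apply (emb_val l k Hk).
  - assert (K : forall a, a ∈ app j c -> opair a a ∈ app j (graph c (app k))).
    { apply (transfer2 l j Hj (fun c g => forall a, a ∈ c -> opair a a ∈ g)
        c (graph c (app k))); auto.
      - bounded.
      - now apply (limit_graph l k Hk Hl).
      - intros a Ha; apply opair_graph; split; auto; now rewrite F. }
    intros a Ha; specialize (K a Ha).
    rewrite (app_graph_dot l j k Hl Hj Hk) in K by assumption.
    symmetry; exact (proj2 (proj1 (opair_graph _ _ _ _) K)).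
Qed.

(** * Agreement of embeddings up to a level *)

Definition agree (t k m : vset) : Prop :=
  forall x y, x ∈ Vr t -> y ∈ Vr t -> (y ∈ app k x <-> y ∈ app m x).

Lemma opair_starcap k t x y :
  opair x y ∈ starcap k t <-> (x ∈ Vr t /\ y ∈ Vr t) /\ y ∈ app k x.
Proof.
  unfold starcap; rewrite mem_sep, opair_prod; split; intros [H K]; split; auto.
  - destruct K as [x' [y' [E K]]]; apply opair_inj in E; destruct E; now subst.
  - eauto.
Qed.

Lemma mem_starcap k t p :
  p ∈ starcap k t -> exists x y, p = opair x y /\ opair x y ∈ starcap k t.
Proof.
  intro Hp; assert (Hp' := Hp); apply mem_sep in Hp'; destruct Hp' as [Hp' _].
  apply mem_prod in Hp'; destruct Hp' as [x [y [_ [_ ->]]]]; eauto.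
Qed.

Lemma starcap_agree k m t : starcap k t = starcap m t <-> agree t k m.
Proof.
  split.
  - intros E x y Hx Hy; pose proof (opair_starcap k t x y) as Hk.
    rewrite E, opair_starcap in Hk; tauto.
  - intro H; apply vset_ext; intro p; split; intro Hp;
      destruct (mem_starcap _ _ _ Hp) as [x [y [-> K]]];
      apply opair_starcap in K; apply opair_starcap; destruct K as [[Hx Hy] K];
      split; auto; now apply (H x y).
Qed.

Lemma agree_refl t k : agree t k k.
Proof. easy. Qed.

Lemma agree_sym t k m : agree t k m -> agree t m k.
Proof. intros H x y Hx Hy; now rewrite (H x y). Qed.

Lemma agree_trans t k m n : agree t k m -> agree t m n -> agree t k n.
Proof. intros H K x y Hx Hy; now rewrite (H x y), (K x y). Qed.

Lemma agree_mono s t k m : s ⊆ t -> agree t k m -> agree s k m.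
Proof. intros Hs H x y Hx Hy; apply H; now apply (Vr_mono s t). Qed.

Lemma emb_starcap j k t : embedding l j -> embedding l k -> t ∈ l ->
  app j (starcap k t) = starcap (dot l j k) (app j t).
Proof.
  intros Hj Hk Ht.
  assert (Ha : Vr t ∈ M) by now apply limit_Vr.
  assert (K := transfer3 l j Hj (fun a g s =>
    (forall p, p ∈ s -> exists x, x ∈ a /\ exists y, y ∈ a /\
       (p = opair x y /\ inapp g x y)) /\
    (forall x, x ∈ a -> forall y, y ∈ a -> inapp g x y -> opair x y ∈ s))
    (Vr t) (graph (Vr t) (app k)) (starcap k t) ltac:(bounded) Ha
    (limit_graph l k Hk Hl _ Ha) (limit_starcap l k Hl t Ht)).
  rewrite (app_graph_dot l j k Hl Hj Hk), (emb_Vr l j Hj) in K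
    by (assumption || now apply sub_Vr).
  apply proj1 in K; destruct K as [K1 K2].
  - split.
    + intros p Hp; destruct (mem_starcap _ _ _ Hp) as [x [y [-> Kp]]].
      apply opair_starcap in Kp; destruct Kp as [[Hx Hy] Kp].
      exists x; split; [assumption|]; exists y; split; [assumption|].
      split; [reflexivity|]; now apply inapp_graph.
    + intros x Hx y Hy Kp; apply inapp_graph in Kp; [|assumption].
      apply opair_starcap; auto.
  - apply vset_ext; intro p; split; intro Hp.
    + destruct (K1 p Hp) as [x [Hx [y [Hy [-> Kp]]]]].
      apply inapp_graph in Kp; [|assumption]; apply opair_starcap; auto.
    + destruct (mem_starcap _ _ _ Hp) as [x [y [-> Kp]]].
      apply opair_starcap in Kp; destruct Kp as [[Hx Hy] Kp].
      apply K2; auto; now apply inapp_graph.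
Qed.

Lemma agree_image h k m t : embedding l h -> embedding l k -> embedding l m ->
  t ∈ l -> agree t k m -> agree (app h t) (dot l h k) (dot l h m).
Proof.
  intros Hh Hk Hm Ht H; apply starcap_agree.
  rewrite <- !emb_starcap by assumption; now rewrite (proj2 (starcap_agree k m t) H).
Qed.

Section LimitAgree.
Variable t : vset.
Hypothesis Ht : t ∈ l.
Hypothesis Lt : limit_ordinal t.

Let below s : s ∈ t -> s ∈ l.
Proof. exact (proj1 (proj1 Hl) t s Ht). Qed.

(** Below a smaller level [s], the values of [dot l k m] are read off from [k]
    at the single argument [starcap m s], which lies in [Vr t]. *)
Lemma agree_dot k k' m m' : embedding l k -> embedding l k' ->
  embedding l m -> embedding l m' ->
  agree t k k' -> agree t m m' -> agree t (dot l k m) (dot l k' m').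
Proof.
  intros Hk Hk' Hm Hm' K L x y Hx Hy.
  destruct (limit_level2 t Lt x y Hx Hy) as [s [Hs [Hxs Hys]]].
  assert (Hsl : s ∈ l) by auto.
  assert (E : starcap m s = starcap m' s).
  { apply starcap_agree, (agree_mono s t); [|assumption].
    apply ordinal_sub; auto; apply Lt. }
  assert (HS : starcap m s ∈ Vr t).
  { apply (Vr_down t (prod (Vr s) (Vr s))).
    - apply limit_prod; auto; now apply limit_Vr.
    - apply starcap_sub. }
  assert (R : forall h n, embedding l h -> embedding l n ->
    (opair x y ∈ app h (starcap n s) <-> y ∈ app (dot l h n) x)).
  { intros h n Hh Hn; rewrite emb_starcap, opair_starcap by assumption.
    pose proof (emb_Vr_increasing l h Hh Hl s Hsl) as I; split; [tauto|].
    intro; split; auto. }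
  rewrite <- (R k m Hk Hm), <- (R k' m' Hk' Hm'), <- E.
  apply K; [assumption|]; now apply limit_opair.
Qed.

(** [y ∈ Vr s] belongs to [app k (app m x)] exactly if it belongs to the image of
    the part of [app m x] in [Vr s], which is a member of [Vr t]. *)
Lemma agree_comp k k' m m' : embedding l k -> embedding l k' ->
  embedding l m -> embedding l m' ->
  agree t k k' -> agree t m m' -> agree t (comp l k m) (comp l k' m').
Proof.
  intros Hk Hk' Hm Hm' K L x y Hx Hy.
  assert (HtM : Vr t ∈ M) by now apply limit_Vr.
  assert (HxM : x ∈ M) by now apply (mem_Vr_trans x (Vr t)).
  rewrite !comp_app by assumption.
  destruct (limit_level t Lt y) as [Hys _].
  destruct (Hys Hy) as [s [Hs Ks]]; assert (Hsl : s ∈ l) by auto.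
  assert (HsM : Vr s ∈ M) by now apply limit_Vr.
  assert (R : forall h n, embedding l h -> embedding l n ->
    (y ∈ app h (cap (app n x) (Vr s)) <-> y ∈ app h (app n x))).
  { intros h n Hh Hn.
    rewrite (emb_cap l h Hh), (emb_Vr l h Hh), mem_cap;
      try assumption; try (now apply sub_Vr); try now apply (emb_val l n Hn).
    pose proof (emb_Vr_increasing l h Hh Hl s Hsl); split; [tauto|]; auto. }
  rewrite <- (R k m Hk Hm), <- (R k' m' Hk' Hm').
  assert (E : cap (app m x) (Vr s) = cap (app m' x) (Vr s)).
  { apply vset_ext; intro z; rewrite !mem_cap.
    split; intros [Hz Hzs]; split; auto; apply (L x z); auto;
      apply (mem_Vr_trans z (Vr s)); auto; now apply limit_Vr. }
  rewrite <- E; apply K; [|assumption].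
  apply (Vr_down t (Vr s)); [now apply limit_Vr|].
  intros z Hz; exact (proj2 (proj1 (mem_cap _ _ _) Hz)).
Qed.
End LimitAgree.

Lemma agree_id k c t : embedding l k -> critical l k c -> t ⊆ c ->
  agree t k (idV l).
Proof.
  intros Hk Hc Ht x y Hx Hy.
  assert (Hxc : x ∈ Vr c) by now apply (Vr_mono t c).
  rewrite idV_app, (critical_fixed k Hk c Hc); [easy|assumption|].
  apply (Vr_mono c l); [|assumption].
  apply ordinal_sub; [apply lord, Hc|apply Hl|]; left; apply Hc.
Qed.

Lemma agree_id_critical k c t : embedding l k -> critical l k c ->
  agree t k (idV l) -> ~ c ∈ Vr t.
Proof.
  intros Hk Hc H Hct.
  apply (mem_irrefl c); rewrite <- (idV_app l c) at 2 by (apply sub_Vr, Hc).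
  apply (H c c); auto; now apply critical_moved.
Qed.

(** That [c] is the critical point of [k] is visible below [c + 1]: [c] is the
    least ordinal that is a member of its own image. *)
Lemma agree_critical k m c t : embedding l k -> embedding l m -> ordinal t ->
  agree t k m -> critical l k c -> c ∈ t -> critical l m c.
Proof.
  intros Hk Hm Ot H Hc Hct; pose proof Hc as [Hcl [_ F]]; split; [assumption|]; split.
  - intro E; apply (mem_irrefl c); rewrite <- E at 2.
    apply (H c c); try now apply sub_Vr.
    now apply critical_moved.
  - intros a Ha.
    assert (Hal : a ∈ l) by exact (proj1 (proj1 Hl) c a Hcl Ha).
    assert (Hat : a ∈ Vr t) by exact (sub_Vr t a (proj1 Ot c a Hct Ha)).
    destruct (proj1 (ordinal_sub a (app m a) (lord a Hal)
      (lord _ (emb_limit l m Hm Hl a Hal))) (emb_increasing l m Hm Hl a Hal)) as [K|K]; auto.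
    destruct (mem_irrefl a); rewrite <- (F a Ha) at 2; now apply (H a a).
Qed.
End Critical.

(** ** Agreement up to a successor level *)

(** A value [y ∈ app (dot l k m) x] with [x] and [y] of rank [t] concerns a pair
    of rank beyond [t + 1].  It is still read off from [k] below [t + 1] if pairs
    are replaced by the disjoint unions [code y x], of rank [t] as well. *)
Definition code (y x : vset) : vset :=
  cup (image y sing) (image x (fun z => upair z (sing z))).

Lemma mem_code y x u :
  u ∈ code y x <-> (exists z, z ∈ y /\ u = sing z) \/
    (exists z, z ∈ x /\ u = upair z (sing z)).
Proof.
  unfold code; rewrite mem_cup, !mem_image; split;
    (intros [[z [Hz E]]|[z [Hz E]]]; [left|right]; exists z; auto).
Qed.

Lemma sing_mem_code y x z : sing z ∈ code y x <-> z ∈ y.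
Proof.
  rewrite mem_code; split.
  - intros [[w [Hw E]]|[w [Hw E]]]; [now rewrite (sing_inj z w E)|].
    assert (H1 : w ∈ sing z) by (rewrite E; apply mem_upair; auto).
    assert (H2 : sing w ∈ sing z) by (rewrite E; apply mem_upair; auto).
    apply mem_sing in H1, H2; subst w.
    destruct (mem_irrefl z); rewrite <- H2 at 2; now apply mem_sing.
  - intro Hz; left; eauto.
Qed.

Lemma upair_mem_code y x z : upair z (sing z) ∈ code y x <-> z ∈ x.
Proof.
  rewrite mem_code; split.
  - intros [[w [Hw E]]|[w [Hw E]]].
    + assert (H1 : z ∈ sing w) by (rewrite <- E; apply mem_upair; auto).
      assert (H2 : sing z ∈ sing w) by (rewrite <- E; apply mem_upair; auto).
      apply mem_sing in H1, H2; subst w.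
      destruct (mem_irrefl z); rewrite <- H2 at 2; now apply mem_sing.
    + assert (H1 : z ∈ upair w (sing w)) by (rewrite <- E; apply mem_upair; auto).
      assert (H2 : w ∈ upair z (sing z)) by (rewrite E; apply mem_upair; auto).
      apply mem_upair in H1, H2.
      destruct H1 as [->|H1]; [assumption|].
      destruct H2 as [->|H2]; [assumption|].
      destruct (mem_asym z w); [rewrite H2|rewrite H1]; now apply mem_sing.
  - intro Hz; right; eauto.
Qed.

Lemma code_inj y x y' x' : code y x = code y' x' -> y = y' /\ x = x'.
Proof.
  intro E; split; apply vset_ext; intro z.
  - now rewrite <- (sing_mem_code y x z), E, sing_mem_code.
  - now rewrite <- (upair_mem_code y x z), E, upair_mem_code.
Qed.

Lemma bounded_code k m n : bounded (fun v => v k = code (v m) (v n)).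
Proof.
  apply (bounded_ext (fun v =>
    (forall u, u ∈ v k -> (exists z, z ∈ v m /\ u = sing z) \/
       (exists z, z ∈ v n /\ exists s, s ∈ u /\ (s = sing z /\ u = upair z s))) /\
    (forall z, z ∈ v m -> exists u, u ∈ v k /\ u = sing z) /\
    (forall z, z ∈ v n -> exists u, u ∈ v k /\
       exists s, s ∈ u /\ (s = sing z /\ u = upair z s)))); [|bounded].
  intro v; split.
  - intros [H1 [H2 H3]]; apply vset_ext; intro u; rewrite mem_code; split.
    + intro Hu; destruct (H1 u Hu) as [H|[z [Hz [s [Hs [-> ->]]]]]]; [auto|].
      right; eauto.
    + intros [[z [Hz ->]]|[z [Hz ->]]].
      * now destruct (H2 z Hz) as [u [Hu ->]].
      * now destruct (H3 z Hz) as [u [Hu [s [_ [-> ->]]]]].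
  - intro E; rewrite E; clear E; split; [|split].
    + intros u Hu; apply mem_code in Hu; destruct Hu as [H|[z [Hz ->]]]; [auto|].
      right; exists z; split; [assumption|]; exists (sing z).
      split; [apply mem_upair|]; auto.
    + intros z Hz; exists (sing z); split; [now apply sing_mem_code|reflexivity].
    + intros z Hz; exists (upair z (sing z)); split; [now apply upair_mem_code|].
      exists (sing z); split; [apply mem_upair|]; auto.
Qed.
#[local] Hint Resolve bounded_code : bounded.

Lemma code_level t y x : limit_ordinal t -> y ⊆ Vr t -> x ⊆ Vr t -> code y x ⊆ Vr t.
Proof.
  intros Lt Hy Hx u Hu; apply mem_code in Hu.
  destruct Hu as [[z [Hz ->]]|[z [Hz ->]]].
  - apply limit_sing; auto.
  - apply limit_upair; auto; apply limit_sing; auto.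
Qed.

Lemma limit_code t y x : limit_ordinal t -> y ∈ Vr t -> x ∈ Vr t -> code y x ∈ Vr t.
Proof.
  intros Lt Hy Hx; destruct (limit_level2 t Lt x y Hx Hy) as [s [Hs [Hxs Hys]]].
  assert (Hss : succ s ∈ t) by now apply Lt.
  apply (limit_sub t _ (succ (succ s))); [now apply Lt|].
  assert (W : forall a, Vr a ⊆ Vr (succ a)).
  { intro a; apply Vr_mono; intros w Hw; apply mem_succ; auto. }
  assert (V : forall a z, z ∈ Vr a -> sing z ∈ Vr (succ a)).
  { intros a z Hz; apply mem_Vr_succ; intros q Hq; apply mem_sing in Hq; now subst q. }
  intros u Hu; apply mem_code in Hu.
  destruct Hu as [[z [Hz ->]]|[z [Hz ->]]].
  - apply W, V; now apply (mem_Vr_trans z y).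
  - assert (Hzs : z ∈ Vr s) by now apply (mem_Vr_trans z x).
    apply mem_Vr_succ; intros q Hq; apply mem_upair in Hq.
    destruct Hq; subst q; [now apply W | now apply V].
Qed.

(** [starcap m t] with its ordered pairs replaced by codes. *)
Definition flat_starcap (m t : vset) : vset :=
  sep (Vr t) (fun u => exists x y, x ∈ Vr t /\ y ∈ Vr t /\ y ∈ app m x /\ u = code y x).

Section SuccessorAgree.
Variable l : vset.
Hypothesis Hl : limit_ordinal l.
Let M : vset := Vr l.

Lemma code_flat_starcap k m t x y : embedding l k -> embedding l m ->
  t ∈ l -> limit_ordinal t -> x ∈ Vr (app k t) -> y ∈ Vr (app k t) ->
  (code y x ∈ app k (flat_starcap m t) <-> y ∈ app (dot l k m) x).
Proof.
  intros Hk Hm Ht Lt Hx Hy.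
  assert (Ha : Vr t ∈ M) by now apply limit_Vr.
  assert (HS : flat_starcap m t ∈ M).
  { apply (Vr_down _ (Vr t)); [assumption|].
    intros u Hu; exact (proj1 (proj1 (mem_sep _ _ _) Hu)). }
  assert (K := transfer3 l k Hk (fun a g s =>
    (forall u, u ∈ s -> exists x, x ∈ a /\ exists y, y ∈ a /\
       (u = code y x /\ inapp g x y)) /\
    (forall x, x ∈ a -> forall y, y ∈ a -> inapp g x y ->
       exists u, u ∈ s /\ u = code y x))
    (Vr t) (graph (Vr t) (app m)) (flat_starcap m t) ltac:(bounded) Ha
    (limit_graph l m Hm Hl _ Ha) HS).
  rewrite (app_graph_dot l k m Hl Hk Hm), (emb_Vr l k Hk) in K
    by (assumption || now apply sub_Vr).
  apply proj1 in K; destruct K as [K1 K2]; [|split].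
  - split.
    + intros u Hu; apply mem_sep in Hu.
      destruct Hu as [_ [x' [y' [Hx' [Hy' [Kp ->]]]]]].
      exists x'; split; [assumption|]; exists y'; split; [assumption|].
      split; [reflexivity|]; now apply inapp_graph.
    + intros x' Hx' y' Hy' Kp; apply inapp_graph in Kp; [|assumption].
      exists (code y' x'); split; [|reflexivity].
      apply mem_sep; split; [now apply limit_code|now exists x', y'].
  - intro H; destruct (K1 _ H) as [x' [Hx' [y' [Hy' [E Kp]]]]].
    apply code_inj in E; destruct E; subst x' y'.
    now apply inapp_graph in Kp.
  - intro H; destruct (K2 x Hx y Hy) as [u [Hu ->]]; [|assumption].
    now apply inapp_graph.
Qed.

(** The hypotheses [t ∈ app k t] and [t ∈ app k' t] place [Vr (succ t)] inside the
    level on which [app k (flat_starcap m t)] codes [dot l k m]. *)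
Lemma agree_dot_succ t k k' m : t ∈ l -> limit_ordinal t ->
  embedding l k -> embedding l k' -> embedding l m ->
  t ∈ app k t -> t ∈ app k' t ->
  agree (succ t) k k' -> agree (succ t) (dot l k m) (dot l k' m).
Proof.
  intros Ht Lt Hk Hk' Hm Mk Mk' H x y Hx Hy.
  assert (R : forall h, embedding l h -> t ∈ app h t ->
    (code y x ∈ app h (flat_starcap m t) <-> y ∈ app (dot l h m) x)).
  { intros h Hh Mh.
    assert (I : Vr (succ t) ⊆ Vr (app h t)).
    { apply Vr_mono, succ_sub; [|assumption].
      now apply (limit_mem_ordinal l Hl), (emb_limit l h Hh Hl). }
    apply code_flat_starcap; auto. }
  rewrite <- (R k Hk Mk), <- (R k' Hk' Mk').
  apply H; apply mem_Vr_succ.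
  - intros u Hu; exact (proj1 (proj1 (mem_sep _ _ _) Hu)).
  - apply code_level; auto; now apply mem_Vr_succ.
Qed.
End SuccessorAgree.

(** * Left powers *)

Section LeftPowers.
Variables l j : vset.
Hypothesis Hl : limit_ordinal l.
Hypothesis Hj : embedding l j.

Lemma embedding_lpow n : embedding l (lpow l j n).
Proof.
  induction n as [|[|n] IH]; [apply embedding_idV|exact Hj|].
  exact (embedding_dot l _ _ Hl IH Hj).
Qed.

Lemma lpow_succ n : lpow l j (S n) = dot l (lpow l j n) j.
Proof. destruct n; [symmetry; now apply dot_idV|reflexivity]. Qed.

Lemma A_lpow n : 1 <= n -> A l j (lpow l j n).
Proof.
  induction n as [|n IH]; [lia|]; intros _; destruct n as [|n]; [constructor|].
  rewrite lpow_succ; apply A_dot; [apply IH; lia|constructor].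
Qed.

Lemma A_P k : A l j k -> P l j k.
Proof. induction 1; [apply P_gen|now apply P_dot]. Qed.

Lemma embedding_P k : P l j k -> embedding l k.
Proof.
  induction 1; [assumption|now apply embedding_dot|now apply embedding_comp].
Qed.

Lemma embedding_A k : A l j k -> embedding l k.
Proof. intro H; now apply embedding_P, A_P. Qed.

Lemma critical_A c k : critical l j c -> A l j k -> exists d, critical l k d.
Proof.
  intros Hc; induction 1 as [|k m Hk _ Hm [d Hd]]; [eauto|].
  exists (app k d); apply dot_critical; auto; now apply embedding_A.
Qed.

Lemma comp_idV k : embedding l k -> comp l (idV l) k = k.
Proof.
  intro Hk; apply (emb_ext l);
    [apply embedding_comp; [apply embedding_idV|]; assumption|assumption|].
  intros x Hx; rewrite comp_app by assumption.
  apply idV_app; now apply (emb_val l k Hk).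
Qed.

(** ** Representation of [P l j] by left powers below a fixed level *)

Section Representation.
Variables (t : vset) (N : nat).
Hypothesis Ht : t ∈ l.
Hypothesis Lt : limit_ordinal t.
Hypothesis HN : 1 <= N.
Hypothesis Hid : agree t (lpow l j N) (idV l).

Lemma dot_top k : embedding l k -> agree t (dot l (lpow l j N) k) k.
Proof.
  intro Hk; rewrite <- (dot_idV l k Hl Hk) at 2.
  apply agree_dot; auto using embedding_idV, embedding_lpow, agree_refl.
Qed.

Lemma comp_top k : embedding l k -> agree t (comp l (lpow l j N) k) k.
Proof.
  intro Hk; rewrite <- (comp_idV k Hk) at 2.
  apply agree_comp; auto using embedding_idV, embedding_lpow, agree_refl.
Qed.

(** As in the Laver tables, row [i] is computed from the rows below it, because
    [j_(i) (j_(k) j) = (j_(i) j_(k)) j_(i+1)] and [j_(i) j_(k)] is a later power. *)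
Lemma dot_lpow_represented i k : 1 <= i < N -> 1 <= k <= N ->
  exists m, i < m <= N /\ agree t (dot l (lpow l j i) (lpow l j k)) (lpow l j m).
Proof.
  remember (N - i) as d eqn:Hd; revert i k Hd.
  induction d as [d IHd] using lt_wf_ind; intros i k Hd Hi.
  induction k as [|k IHk]; intro Hk; [lia|].
  destruct k as [|k].
  - exists (S i); split; [lia|]; rewrite (lpow_succ i); apply agree_refl.
  - destruct IHk as [m [Hm E]]; [lia|].
    assert (E' : agree t (dot l (lpow l j i) (lpow l j (S (S k))))
                         (dot l (lpow l j m) (lpow l j (S i)))).
    { rewrite (lpow_succ (S k)), dot_distributive, <- (lpow_succ i) by auto using embedding_lpow.
      apply agree_dot; auto using embedding_lpow, embedding_dot, agree_refl. }
    destruct (Nat.eq_dec m N) as [->|Hne].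
    + exists (S i); split; [lia|].
      apply (agree_trans _ _ _ _ E'), dot_top, embedding_lpow.
    + destruct (IHd (N - m)) with (i := m) (k := S i) as [r [Hr Er]]; try lia.
      exists r; split; [lia|]; exact (agree_trans _ _ _ _ E' Er).
Qed.

(** [j_(i) ∘ j_(k) = (j_(i) j_(k)) ∘ j_(i)], and [j_(i) j_(k)] is a later power
    than [j_(i)], so iterating this leads to [j_(N)], the identity. *)
Lemma comp_lpow_represented i k : 1 <= i <= N -> 1 <= k <= N ->
  exists m, 1 <= m <= N /\ agree t (comp l (lpow l j i) (lpow l j k)) (lpow l j m).
Proof.
  remember (N - i) as d eqn:Hd; revert i k Hd.
  induction d as [d IHd] using lt_wf_ind; intros i k Hd Hi Hk.
  destruct (Nat.eq_dec i N) as [->|Hne].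
  { exists k; split; [assumption|]; apply comp_top, embedding_lpow. }
  destruct (dot_lpow_represented i k) as [m [Hm E]]; [lia|lia|].
  destruct (IHd (N - m)) with (i := m) (k := i) as [r [Hr Er]]; try lia.
  exists r; split; [lia|]; apply agree_trans with (2 := Er).
  rewrite (comp_dot l (lpow l j i)) by auto using embedding_lpow.
  apply agree_comp; auto using embedding_lpow, embedding_dot, agree_refl.
Qed.

Lemma P_represented p : P l j p ->
  exists i, 1 <= i <= N /\ agree t p (lpow l j i).
Proof.
  induction 1 as [|p q Hp [i [Hi Ei]] Hq [k [Hk Ek]]|p q Hp [i [Hi Ei]] Hq [k [Hk Ek]]].
  - exists 1; split; [lia|]; apply agree_refl.
  - assert (E : agree t (dot l p q) (dot l (lpow l j i) (lpow l j k))).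
    { apply agree_dot; auto using embedding_lpow, embedding_P. }
    destruct (Nat.eq_dec i N) as [->|Hne].
    + exists k; split; [assumption|].
      apply (agree_trans _ _ _ _ E), dot_top, embedding_lpow.
    + destruct (dot_lpow_represented i k) as [m [Hm Em]]; [lia|lia|].
      exists m; split; [lia|]; exact (agree_trans _ _ _ _ E Em).
  - destruct (comp_lpow_represented i k Hi Hk) as [m [Hm Em]].
    exists m; split; [assumption|]; apply agree_trans with (2 := Em).
    apply agree_comp; auto using embedding_lpow, embedding_P.
Qed.
End Representation.
End LeftPowers.

(** * The critical sequence *)

Lemma odd_part i : 1 <= i -> exists v q, i = 2 ^ v * (2 * q + 1).
Proof.
  induction i as [i IH] using lt_wf_ind; intro Hi.
  destruct (Nat.Even_or_Odd i) as [[r E]|[r E]].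
  - destruct (IH r) as [v [q Hq]]; [lia|lia|].
    exists (S v), q; rewrite E, Hq, Nat.pow_succ_r'; lia.
  - exists 0, r; simpl; lia.
Qed.

Lemma odd_part_exponent v q n : 2 ^ v * (2 * q + 1) < 2 ^ n -> v < n.
Proof.
  intro H; apply (Nat.pow_lt_mono_r_iff 2); [lia|]; nia.
Qed.

Section CriticalSequence.
Variables (l j : vset) (gamma : nat -> vset).
Hypothesis Hl : limit_ordinal l.
Hypothesis Hj : embedding l j.
Hypothesis Hne : j <> idV l.
Hypothesis Hgamma : increasing_enumeration (crA l j) gamma.

Lemma critical_A_gamma k : A l j k -> exists n, critical l k (gamma n).
Proof.
  intro Hk; destruct (critical_exists l Hl j Hj Hne) as [c0 Hc0].
  destruct (critical_A l j Hl Hj c0 k Hc0 Hk) as [c Hc].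
  destruct (proj1 (proj2 Hgamma c)) as [n ->]; [|eauto].
  exists k; split; [assumption|]; symmetry; now apply critical_cr.
Qed.

Lemma gamma_critical n : exists k, A l j k /\ critical l k (gamma n).
Proof.
  destruct (proj2 (proj2 Hgamma (gamma n))) as [k [Hk E]]; [eauto|].
  exists k; split; [assumption|].
  destruct (critical_A_gamma k Hk) as [m Hm].
  now rewrite E, (critical_cr l Hl k (gamma m) Hm).
Qed.

Lemma gamma_mem n : gamma n ∈ l.
Proof. now destruct (gamma_critical n) as [k [_ [H _]]]. Qed.

Lemma gamma_ordinal n : ordinal (gamma n).
Proof. exact (limit_mem_ordinal l Hl _ (gamma_mem n)). Qed.

Lemma gamma_limit n : limit_ordinal (gamma n).
Proof.
  destruct (gamma_critical n) as [k [Hk Hc]].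
  now apply (critical_limit l Hl k (embedding_A l j Hl Hj k Hk)).
Qed.

Lemma gamma_lt m n : m < n <-> gamma m ∈ gamma n.
Proof.
  split; [apply Hgamma|]; intro H.
  destruct (Nat.lt_trichotomy m n) as [K|[K|K]]; [assumption| |].
  - subst n; now destruct (mem_irrefl (gamma m)).
  - destruct (mem_asym _ _ H); now apply Hgamma.
Qed.

Lemma gamma_le m n : m <= n -> gamma m ⊆ gamma n.
Proof.
  intro H; apply ordinal_sub; try apply gamma_ordinal.
  destruct (Nat.eq_dec m n) as [->|Hmn]; [auto|]; left; apply gamma_lt; lia.
Qed.

Lemma critical_index k m n : critical l k (gamma m) -> critical l k (gamma n) -> m = n.
Proof.
  intros Hm Hn; pose proof (critical_unique l Hl k _ _ Hm Hn) as E.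
  destruct (Nat.lt_trichotomy m n) as [K|[K|K]]; [|assumption|];
    apply gamma_lt in K; rewrite E in K; now destruct (mem_irrefl (gamma n)).
Qed.

Lemma gamma_image k n : A l j k -> exists p, app k (gamma n) = gamma p.
Proof.
  intro Hk; destruct (gamma_critical n) as [a [Ha Hc]].
  assert (Hka : critical l (dot l k a) (app k (gamma n))).
  { apply dot_critical; auto; now apply (embedding_A l j). }
  destruct (critical_A_gamma (dot l k a)) as [p Hp]; [now apply A_dot|].
  exists p; exact (critical_unique l Hl _ _ _ Hka Hp).
Qed.

(** An element [k] of [A l j] maps critical points to critical points, in
    increasing order, and its own critical point upwards. *)
Lemma gamma_climb k v m : A l j k -> critical l k (gamma v) -> v <= m ->
  exists p, m < p /\ app k (gamma m) = gamma p.
Proof.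
  intros Hk Hv; pose proof (embedding_A l j Hl Hj k Hk) as Ek.
  induction 1 as [|m Hm [p [Hp E]]].
  - destruct (gamma_image k v Hk) as [p E]; exists p; split; [|assumption].
    apply gamma_lt; rewrite <- E; now apply (critical_moved l Hl).
  - destruct (gamma_image k (S m) Hk) as [q Eq]; exists q; split; [|assumption].
    enough (p < q) by lia; apply gamma_lt; rewrite <- E, <- Eq.
    apply (emb_mem_val l k Ek); [apply sub_Vr, gamma_mem|]; apply gamma_lt; lia.
Qed.

(** An element of [A l j] with critical point [gamma n] agrees below [t] with one
    of the first [N] left powers, which then has this critical point as well. *)
Lemma critical_realized t N n : t ∈ l -> limit_ordinal t -> 1 <= N ->
  agree t (lpow l j N) (idV l) -> gamma n ∈ t ->
  exists i, 1 <= i < N /\ critical l (lpow l j i) (gamma n).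
Proof.
  intros Ht Lt HN Hid Hn; destruct (gamma_critical n) as [k [Hk Hc]].
  destruct (P_represented l j Hl Hj t N Ht Lt HN Hid k (A_P l j k Hk)) as [i [Hi E]].
  assert (Ei : critical l (lpow l j i) (gamma n)).
  { apply (agree_critical l Hl k _ _ t); auto; [|apply embedding_lpow; auto|apply Lt].
    now apply (embedding_A l j). }
  exists i; split; [|assumption].
  destruct (Nat.eq_dec i N) as [->|Hne']; [|lia].
  destruct (agree_id_critical l Hl _ (gamma n) t (embedding_lpow l j Hl Hj N) Ei Hid).
  now apply sub_Vr.
Qed.

Lemma critical_gamma_0 : critical l j (gamma 0).
Proof.
  destruct (critical_A_gamma j (A_gen l j)) as [[|n] Hn]; [assumption|].
  destruct (critical_realized (gamma (S n)) 1 0) as [i [Hi _]]; try lia.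
  - apply gamma_mem.
  - apply gamma_limit.
  - apply (agree_id l Hl j (gamma (S n))); auto; easy.
  - apply gamma_lt; lia.
Qed.

(** Indices are written [2 ^ v * (2 * q + 1)], so that [v] is the exponent of the
    largest power of 2 that divides them. *)
Definition critical_up_to n : Prop := forall v q,
  2 ^ v * (2 * q + 1) <= 2 ^ n ->
  critical l (lpow l j (2 ^ v * (2 * q + 1))) (gamma v).

Lemma critical_up_to_power n : critical_up_to n -> critical l (lpow l j (2 ^ n)) (gamma n).
Proof.
  intro H; specialize (H n 0); now rewrite Nat.mul_1_r in H; apply H.
Qed.

Lemma critical_up_to_lt n i : critical_up_to n -> 1 <= i < 2 ^ n ->
  exists v, v < n /\ critical l (lpow l j i) (gamma v).
Proof.
  intros H Hi; destruct (odd_part i) as [v [q E]]; [lia|].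
  exists v; split.
  - apply (odd_part_exponent v q); lia.
  - rewrite E; apply H; lia.
Qed.

Section Step.
Variable n : nat.
Hypothesis Hn : critical_up_to n.
Let N := 2 ^ n.
Let k := lpow l j N.

Let N_pos : 1 <= N.
Proof. unfold N; pose proof (Nat.pow_nonzero 2 n); lia. Qed.

Let Ek i : embedding l (lpow l j i).
Proof. now apply embedding_lpow. Qed.

Let Hk : critical l k (gamma n) := critical_up_to_power n Hn.

Let agree_shift i : agree (gamma n) (lpow l j (N + i)) (lpow l j i).
Proof.
  induction i as [|i IH].
  - rewrite Nat.add_0_r; apply (agree_id l Hl _ (gamma n)); auto; easy.
  - rewrite Nat.add_succ_r, !lpow_succ by assumption.
    apply agree_dot; auto using agree_refl, gamma_mem, gamma_limit.
Qed.

Let critical_shift i v : 1 <= i < N -> v < n ->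
  critical l (lpow l j i) (gamma v) -> critical l (lpow l j (N + i)) (gamma v).
Proof.
  intros Hi Hv Hc; apply (agree_critical l Hl (lpow l j i) _ _ (gamma n)); auto using gamma_ordinal.
  - apply agree_sym, agree_shift.
  - now apply gamma_lt.
Qed.

(** [lpow l j i] maps the fixed point [gamma (n - 1)] of [k] to [gamma n] or
    beyond, and [k] maps that value to [app k (gamma n)] or beyond. *)
Let image_above i : 1 <= i < N ->
  agree (app k (gamma n)) (dot l k (lpow l j i)) (lpow l j (N + i)) ->
  app k (gamma n) ⊆ app (lpow l j (N + i)) (gamma n).
Proof.
  intros Hi E; destruct (critical_up_to_lt n i Hn Hi) as [v [Hv Hc]].
  assert (Hm : exists m, n = S m) by (exists (n - 1); lia); destruct Hm as [m Em].
  assert (HA : A l j (lpow l j i)) by (apply A_lpow; auto; lia).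
  assert (HAk : A l j k) by (apply A_lpow; auto).
  destruct (gamma_climb (lpow l j i) v m HA Hc) as [p [Hp Ep]]; [lia|].
  destruct (gamma_climb k n n HAk Hk) as [r [Hr Er]]; [lia|].
  assert (Hmn : gamma m ∈ gamma n) by (apply gamma_lt; lia).
  assert (HM : forall q, gamma q ∈ Vr l) by (intro; apply sub_Vr, gamma_mem).
  assert (Hfix : app k (gamma m) = gamma m).
  { apply (critical_fixed l Hl k (Ek N) (gamma n) Hk); now apply sub_Vr. }
  assert (Hval : app (dot l k (lpow l j i)) (gamma m) = app k (gamma p)).
  { rewrite <- Hfix at 1; rewrite <- (dot_app l k (lpow l j i)) by (unfold k; auto).
    now rewrite Ep. }
  assert (Hsub : app k (gamma n) ⊆ app k (gamma p)).
  { apply (emb_sub l k (Ek N)); auto; apply gamma_le; lia. }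
  intros x Hx.
  assert (K : x ∈ app (lpow l j (N + i)) (gamma m)).
  { apply E; [|now apply sub_Vr|rewrite Hval; auto].
    rewrite Er; apply sub_Vr, gamma_lt; lia. }
  assert (O : ordinal (app (lpow l j (N + i)) (gamma n))).
  { apply (emb_ordinal l _ (Ek _)); auto using gamma_ordinal. }
  apply (proj1 O (app (lpow l j (N + i)) (gamma m))); [|assumption].
  now apply (emb_mem_val l _ (Ek _)).
Qed.

(** The recursion for [dot l k (lpow l j i)] multiplies on the right by
    [lpow l j (N + 1)], the one for [lpow l j (N + i)] by [j].  These factors
    agree only below [gamma n], but the embedding on their left stretches the
    agreement. *)
Let agree_double i : 1 <= i <= N ->
  agree (app k (gamma n)) (dot l k (lpow l j i)) (lpow l j (N + i)).
Proof.
  assert (Hd : app k (gamma n) ∈ l) by (apply (emb_limit l k (Ek N) Hl), gamma_mem).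
  assert (Ld : limit_ordinal (app k (gamma n))).
  { destruct (gamma_image k n) as [p ->]; [apply A_lpow; auto|apply gamma_limit]. }
  induction i as [|i IH]; intro Hi; [lia|].
  destruct (Nat.eq_dec i 0) as [->|Hi0].
  - replace (N + 1) with (S N) by lia; rewrite (lpow_succ l j Hl Hj N); apply agree_refl.
  - assert (E : agree (app k (gamma n)) (dot l k (lpow l j i)) (lpow l j (N + i)))
      by (apply IH; lia).
    rewrite Nat.add_succ_r, !lpow_succ by assumption.
    rewrite dot_distributive by (unfold k; auto).
    change (dot l k j) with (dot l (lpow l j N) j).
    rewrite <- (lpow_succ l j Hl Hj N).
    apply agree_trans with (dot l (lpow l j (N + i)) (lpow l j (S N))).
    + apply agree_dot; unfold k; auto using embedding_dot, agree_refl.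
    + apply (agree_mono _ (app (lpow l j (N + i)) (gamma n))).
      * apply image_above; [lia|assumption].
      * apply agree_image; auto using gamma_mem.
        replace (S N) with (N + 1) by lia; apply (agree_shift 1).
Qed.

(** If the critical point of the next power skipped [gamma (S n)], the powers
    below it, whose critical points are known, would represent all embeddings up
    to [gamma (S n)], and none would have that critical point. *)
Lemma critical_double :
  critical l (lpow l j (N + N)) (gamma (S n)) /\ app k (gamma n) = gamma (S n).
Proof.
  assert (HAk : A l j k) by (apply A_lpow; auto).
  destruct (gamma_climb k n n HAk Hk) as [p [Hp Ep]]; [lia|].
  assert (HA2 : A l j (lpow l j (N + N))) by (apply A_lpow; auto; lia).
  destruct (critical_A_gamma _ HA2) as [q Hq].
  assert (Hid : agree (gamma p) (lpow l j (N + N)) (idV l)).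
  { rewrite <- Ep; apply agree_trans with (dot l k k).
    - apply agree_sym, agree_double; lia.
    - apply (agree_id l Hl _ (app k (gamma n))); [| |easy].
      + unfold k; apply embedding_dot; auto.
      + apply dot_critical; unfold k; auto. }
  assert (Hpq : p <= q).
  { destruct (le_lt_dec p q) as [H|H]; [assumption|].
    destruct (agree_id_critical l Hl _ _ _ (Ek _) Hq Hid).
    now apply sub_Vr, gamma_lt. }
  assert (Hqn : q <= S n).
  { destruct (le_lt_dec q (S n)) as [H|H]; [assumption|].
    destruct (critical_realized (gamma q) (N + N) (S n)) as [i [Hi Hc]];
      auto using gamma_mem, gamma_limit; [lia| |now apply gamma_lt|].
    { apply (agree_id l Hl _ (gamma q)); auto; easy. }
    assert (Hv : exists v, v <= n /\ critical l (lpow l j i) (gamma v)).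
    { destruct (Nat.lt_trichotomy i N) as [H1|[H1|H1]].
      - destruct (critical_up_to_lt n i Hn) as [v [Hv Hcv]]; [unfold N in *; lia|].
        exists v; split; [lia|assumption].
      - exists n; split; [lia|]; now rewrite H1.
      - destruct (critical_up_to_lt n (i - N) Hn) as [v [Hv Hcv]]; [unfold N in *; lia|].
        exists v; split; [lia|]; replace i with (N + (i - N)) by lia.
        apply critical_shift; auto; lia. }
    destruct Hv as [v [Hv Hcv]].
    pose proof (critical_index _ _ _ Hc Hcv); lia. }
  assert (Hp' : p = S n) by lia; assert (Hq' : q = S n) by lia.
  subst p q; auto.
Qed.

Lemma critical_up_to_succ : critical_up_to (S n).
Proof.
  assert (H2 : 2 ^ S n = N + N) by (unfold N; rewrite Nat.pow_succ_r'; lia).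
  intros v q Hle; rewrite H2 in Hle.
  destruct (le_lt_dec (2 ^ v * (2 * q + 1)) N) as [H|H]; [now apply Hn|].
  destruct (Nat.eq_dec (2 ^ v * (2 * q + 1)) (N + N)) as [E|Hlt].
  - assert (Hv : v = S n).
    { destruct (Nat.lt_trichotomy v (S n)) as [Hv|[Hv|Hv]]; [|assumption|].
      - (* an odd number is not a positive power of 2 *)
        exfalso; rewrite <- H2 in E.
        replace (S n) with (v + S (n - v)) in E by lia.
        rewrite Nat.pow_add_r, Nat.pow_succ_r' in E.
        apply Nat.mul_cancel_l in E; [lia|]; now apply Nat.pow_nonzero.
      - exfalso; apply (Nat.pow_lt_mono_r 2) in Hv; [nia|lia]. }
    rewrite E, Hv; apply critical_double.
  - assert (Hv : v < S n) by (apply (odd_part_exponent v q); lia).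
    destruct (Nat.eq_dec v n) as [->|Hvn]; [exfalso; unfold N in H, Hle, Hlt; destruct q; nia|].
    set (r := 2 ^ (n - v - 1)).
    assert (EN : N = 2 ^ v * (2 * r)).
    { unfold N, r; replace n with (v + S (n - v - 1)) at 1 by lia.
      now rewrite Nat.pow_add_r, Nat.pow_succ_r'. }
    assert (Hr : r <= q) by nia.
    replace (2 ^ v * (2 * q + 1)) with (N + 2 ^ v * (2 * (q - r) + 1)) in *.
    + apply critical_shift; [|lia|].
      * pose proof (Nat.pow_nonzero 2 v); nia.
      * apply Hn; change (2 ^ n) with N; lia.
    + rewrite EN; replace q with (r + (q - r)) at 2 by lia; nia.
Qed.
End Step.

Lemma critical_all n : critical_up_to n.
Proof.
  induction n as [|n IH]; [|now apply critical_up_to_succ].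
  intros v q H; simpl in H; pose proof (Nat.pow_nonzero 2 v).
  assert (q = 0) by nia; subst q.
  destruct v as [|v]; [apply critical_gamma_0|].
  rewrite Nat.pow_succ_r' in H; pose proof (Nat.pow_nonzero 2 v); lia.
Qed.

Lemma critical_lpow v q : critical l (lpow l j (2 ^ v * (2 * q + 1))) (gamma v).
Proof.
  apply (critical_all (2 ^ v * (2 * q + 1))).
  apply Nat.lt_le_incl, Nat.pow_gt_lin_r; lia.
Qed.

Lemma critical_lpow_power n : critical l (lpow l j (2 ^ n)) (gamma n).
Proof. apply critical_up_to_power, critical_all. Qed.

Lemma lpow_power_gamma n : app (lpow l j (2 ^ n)) (gamma n) = gamma (S n).
Proof. apply critical_double, critical_all. Qed.

Lemma lpow_power_id n : agree (gamma n) (lpow l j (2 ^ n)) (idV l).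
Proof.
  apply (agree_id l Hl _ (gamma n)); [now apply embedding_lpow| |easy].
  apply critical_lpow_power.
Qed.

(** Right multiplication by [j] preserves agreement up to [gamma n + 1], so an
    agreement of [lpow l j i] and [lpow l j m] leads to an agreement of an earlier
    power with [lpow l j (2 ^ S n)], which is the identity there. *)
Lemma lpow_disagree n i m : i < m -> m < 2 ^ S n ->
  ~ agree (succ (gamma n)) (lpow l j i) (lpow l j m).
Proof.
  assert (Hcrit : forall r, 1 <= r < 2 ^ S n ->
    exists v, v <= n /\ critical l (lpow l j r) (gamma v)).
  { intros r Hr; destruct (critical_up_to_lt (S n) r (critical_all _) Hr) as [v [Hv Hc]].
    exists v; split; [lia|assumption]. }
  assert (Hnid : forall r, 1 <= r < 2 ^ S n ->
    ~ agree (succ (gamma n)) (lpow l j r) (idV l)).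
  { intros r Hr H; destruct (Hcrit r Hr) as [v [Hv Hc]].
    apply (agree_id_critical l Hl _ _ _ (embedding_lpow l j Hl Hj r) Hc H).
    apply mem_Vr_succ; intros x Hx; apply sub_Vr; now apply (gamma_le v n). }
  assert (Hmove : forall r, 1 <= r < 2 ^ S n ->
    gamma n ∈ app (lpow l j r) (gamma n)).
  { intros r Hr; destruct (Hcrit r Hr) as [v [Hv Hc]].
    destruct (gamma_climb (lpow l j r) v n) as [p [Hp ->]]; auto;
      [apply A_lpow; auto; lia|now apply gamma_lt]. }
  assert (K : forall d i m, m + d = 2 ^ S n -> 1 <= i < m ->
    ~ agree (succ (gamma n)) (lpow l j i) (lpow l j m)).
  { clear i m; induction d as [|d IH]; intros i m Hm Hi H.
    - apply (Hnid i); [lia|]; apply (agree_trans _ _ _ _ H).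
      replace m with (2 ^ S n) by lia.
      apply (agree_mono _ (gamma (S n))); [|apply lpow_power_id].
      apply succ_sub; [apply gamma_ordinal|]; apply gamma_lt; lia.
    - apply (IH (S i) (S m)); [lia|lia|]; rewrite !lpow_succ by assumption.
      apply agree_dot_succ; auto using gamma_mem, gamma_limit, embedding_lpow;
        apply Hmove; lia. }
  intros Hi Hm H; destruct i as [|i].
  - apply (Hnid m); [lia|]; now apply agree_sym.
  - apply (K (2 ^ S n - m) (S i) m); auto; lia.
Qed.
End CriticalSequence.

Theorem theorem11 (lam j : vset) (gamma : nat -> vset)
    (Hlam : limit_ordinal lam) (Hj : E lam j)
    (Hgamma : increasing_enumeration (crA lam j) gamma) :
  (* (i) *)
  ((forall n : nat,
      app (lpow lam j (2 ^ n)) (cr lam (lpow lam j (2 ^ n)))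
      = cr lam (lpow lam j (2 ^ (n + 1)))) /\
   (forall m n : nat, m < n ->
      mem (cr lam (lpow lam j (2 ^ m))) (cr lam (lpow lam j (2 ^ n)))) /\
   (forall m n : nat, 1 <= m ->
      Nat.divide (2 ^ n) m ->
      (forall k : nat, Nat.divide (2 ^ k) m -> k <= n) ->
      cr lam (lpow lam j m) = cr lam (lpow lam j (2 ^ n)))) /\
  (* (ii) *)
  (forall n : nat, cr lam (lpow lam j (2 ^ n)) = gamma n) /\
  (* (iii) *)
  (forall n i m : nat, 1 <= n -> i < 2 ^ n -> m < 2 ^ n -> i <> m ->
     starcap (lpow lam j i) (succ (gamma (n - 1)))
     <> starcap (lpow lam j m) (succ (gamma (n - 1)))) /\
  (* (iv) *)
  (forall (n : nat) (s : vset),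
     Pn lam j (gamma n) s <->
     exists i : nat, i < 2 ^ n /\ s = starcap (lpow lam j i) (gamma n)).
Proof.
  destruct Hj as [He Hne]; pose proof (elementary_embedding lam j He) as Ej.
  pose proof (critical_lpow lam j gamma Hlam Ej Hne Hgamma) as Hodd.
  pose proof (lpow_power_id lam j gamma Hlam Ej Hne Hgamma) as Hid.
  assert (Hcr : forall n, cr lam (lpow lam j (2 ^ n)) = gamma n).
  { intro n; apply critical_cr; [assumption|]; now apply critical_lpow_power. }
  split; [split; [|split]|split; [assumption|split]].
  - intro n; rewrite !Hcr, Nat.add_1_r; now apply lpow_power_gamma.
  - intros m n Hmn; rewrite !Hcr; now apply Hgamma.
  - intros m n Hm [r Hr] Hmax; rewrite Hcr.
    destruct (Nat.Even_or_Odd r) as [[q E]|[q E]]; subst r m.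
    + enough (S n <= n) by lia; apply Hmax; exists q.
      rewrite Nat.pow_succ_r'; lia.
    + rewrite Nat.mul_comm; apply critical_cr; [assumption|apply Hodd].
  - intros [|n] i m Hn Hi Hm Him Hs; [lia|].
    replace (S n - 1) with n in Hs by lia; apply starcap_agree in Hs.
    destruct (Nat.lt_gt_cases i m) as [H _]; destruct (H Him) as [K|K].
    + now apply (lpow_disagree lam j gamma Hlam Ej Hne Hgamma n i m).
    + apply agree_sym in Hs.
      now apply (lpow_disagree lam j gamma Hlam Ej Hne Hgamma n m i).
  - intros n s; assert (Hpos : 1 <= 2 ^ n) by (pose proof (Nat.pow_nonzero 2 n); lia).
    split.
    + intros [p [Hp ->]].
      destruct (P_represented lam j Hlam Ej (gamma n) (2 ^ n)) with (p := p)
        as [i [Hi Ei]]; auto.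
      * exact (gamma_mem lam j gamma Hlam Ej Hne Hgamma n).
      * exact (gamma_limit lam j gamma Hlam Ej Hne Hgamma n).
      * destruct (Nat.eq_dec i (2 ^ n)) as [->|Hlt].
        -- exists 0; split; [lia|]; apply starcap_agree.
           exact (agree_trans _ _ _ _ Ei (Hid n)).
        -- exists i; split; [lia|]; now apply starcap_agree.
    + intros [[|i] [Hi ->]].
      * exists (lpow lam j (2 ^ n)); split; [now apply A_P, A_lpow|].
        apply starcap_agree, agree_sym, Hid.
      * exists (lpow lam j (S i)); split; [|reflexivity].
        apply A_P, A_lpow; auto; lia.
Qed.
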